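(* Let $G=(V,E)$ be a finite undirected graph, let $\emptyset\neq V_0\subsetneq V_1\subsetneq\cdots\subsetneq V_k\subsetneq V$ be a chain of vertex sets, and let $x\in\mathbb{R}^E$ be a chain-point for this chain. Let the distinct values among the narrow cut sizes $x(\delta(V_i))$, $i=0,\dots,k$, be $2-\lambda_1>2-\lambda_1-\lambda_2>\cdots>2-\lambda_1-\cdots-\lambda_\ell=1$ (so $\ell$ is the number of distinct values and $\lambda_1,\dots,\lambda_\ell>0$). For $j=1,\dots,\ell$ let $\mathcal{B}_j$ be the set of Gao-trees of $G$ for the chain formed by the sets $\{V_i: x(\delta(V_i))\le 2-\lambda_1-\cdots-\lambda_j\}$. Then there exists a layered convex combination for $x$, i.e., there exist $x_1,\dots,x_\ell\in\mathbb{R}^E$ such that each $x_j$ lies in the convex hull of (the incidence vectors of) the trees in $\mathcal{B}_j$ and $x=\sum_{j=1}^{\ell}\lambda_j x_j$.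
   Context: For $S_1,S_2\subseteq V$, $\delta(S_1,S_2)$ is the set of edges with one end in $S_1$ and the other in $S_2$; $E(S)=\delta(S,S)$; $\delta(S)=\delta(S,V\setminus S)$; $\delta(v)=\delta(\{v\})$. For $F\subseteq E$, $x(F)=\sum_{e\in F}x_e$; edge sets are identified with their incidence vectors. The spanning tree polytope is $\mathrm{Sp}(G)=\{x\in\mathbb{R}^E: x\ge 0,\ x(E(U))\le |U|-1 \text{ for all nonempty } U\subseteq V,\ x(E)=|V|-1\}$. Given a chain $\emptyset\neq V_0\subsetneq V_1\subsetneq\cdots\subsetneq V_k\subsetneq V$, set $V_{-1}=\emptyset$, $V_{k+1}=V$ and define the level sets $L_i=V_i\setminus V_{i-1}$ for $i=0,\dots,k+1$. A vector $x\in\mathbb{R}^E$ is a chain-point for the chain if (i) $x\in\mathrm{Sp}(G)$; (ii) $x(\delta(V_0))=x(\delta(V_k))=1$ and $x(\delta(V_i))<2$ for $i=1,\dots,k-1$; (iii) $\sum_{v\in L_i}x(\delta(v))=2|L_i|$ for $i=1,\dots,k$. A Gao-tree for a chain $W_0\subsetneq\cdots\subsetneq W_m$ is a spanning tree of $G$ that contains exactly one edge of each cut $\delta(W_i)$, $i=0,\dots,m$. The values $x(\delta(V_i))$ are called narrow cut sizes. *)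

(* Defs.v *)
From mathcomp Require Import all_boot all_order all_algebra.
From mathcomp Require Import reals.

Set Implicit Arguments.
Unset Strict Implicit.
Unset Printing Implicit Defensive.

Import Order.TTheory GRing.Theory Num.Theory.

Local Open Scope ring_scope.

(* A finite undirected graph has finite types V of vertices and E of edges;
   ends e lists the two ends of e in an arbitrary order, which every notion
   below ignores.  Parallel edges and loops are allowed; every point of the
   spanning tree polytope vanishes on loops. *)

Section Graph.
Variables (V E : finType) (ends : E -> V * V).

Definition joins (e : E) (u v : V) : bool :=
  (ends e == (u, v)) || (ends e == (v, u)).

Definition edges_between (S1 S2 : {set V}) : {set E} :=
  [set e | ((ends e).1 \in S1) && ((ends e).2 \in S2)
        || ((ends e).1 \in S2) && ((ends e).2 \in S1)].

Definition induced_edges (S : {set V}) : {set E} := edges_between S S.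

Definition cut (S : {set V}) : {set E} := edges_between S (~: S).

Definition spans_connected (T : {set E}) : Prop :=
  forall u v : V, connect (fun a b => [exists e in T, joins e a b]) u v.

(* A cycle of length n.+1: loops are the cycles of length 1 and pairs of
   parallel edges those of length 2; ordS is the cyclic successor. *)
Definition has_cycle (T : {set E}) : Prop :=
  exists (n : nat) (v : 'I_n.+1 -> V) (e : 'I_n.+1 -> E),
    [/\ injective v, injective e, (forall i, e i \in T)
      & forall i, joins (e i) (v i) (v (ordS i))].

Definition spanning_tree (T : {set E}) : Prop :=
  spans_connected T /\ ~ has_cycle T.

(* Only the members of the chain matter, so it is given as a set of sets. *)
Definition Gao_tree (W : {set {set V}}) (T : {set E}) : Prop :=
  spanning_tree T /\ forall S, S \in W -> #|T :&: cut S| = 1%N.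

Definition is_chain (k : nat) (C : 'I_k.+1 -> {set V}) : Prop :=
  [/\ C ord0 != set0, (forall i j : 'I_k.+1, (i < j)%N -> C i \proper C j)
    & C ord_max \proper [set: V]].

Definition chain_at (k : nat) (C : 'I_k.+1 -> {set V}) (i : nat) : {set V} :=
  if insub i is Some j then C j else [set: V].

Definition level (k : nat) (C : 'I_k.+1 -> {set V}) (i : nat) : {set V} :=
  chain_at C i :\: (if i is i'.+1 then chain_at C i' else set0).

Section Weights.
Variable R : realType.

Definition weight (x : E -> R) (F : {set E}) : R := \sum_(e in F) x e.

Definition in_spanning_tree_polytope (x : E -> R) : Prop :=
  [/\ forall e, 0 <= x e,
      forall U : {set V}, U != set0 ->
        weight x (induced_edges U) <= #|U|%:R - 1
    & weight x [set: E] = #|V|%:R - 1].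

Definition chain_point (k : nat) (C : 'I_k.+1 -> {set V}) (x : E -> R) : Prop :=
  [/\ in_spanning_tree_polytope x,
      [/\ weight x (cut (C ord0)) = 1, weight x (cut (C ord_max)) = 1
        & forall i : 'I_k.+1, (0 < i < k)%N -> weight x (cut (C i)) < 2]
    & forall i : nat, (1 <= i <= k)%N ->
        \sum_(v in level C i) weight x (cut [set v]) = 2 * #|level C i|%:R].

(* With layers indexed from 0, layer_value lam j is
   2 - lambda_1 - ... - lambda_(j+1). *)
Definition layer_value (l : nat) (lam : 'I_l -> R) (j : 'I_l) : R :=
  2 - \sum_(t < l | (t <= j)%N) lam t.

(* Positivity of lam makes the layer values pairwise distinct and strictly
   decreasing, so l is the number of distinct narrow cut sizes. *)
Definition narrow_cut_layers (k : nat) (C : 'I_k.+1 -> {set V}) (x : E -> R)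
    (l : nat) (lam : 'I_l -> R) : Prop :=
  [/\ forall j, 0 < lam j,
      forall r : R, (exists i, weight x (cut (C i)) = r)
                    <-> (exists j, layer_value lam j = r)
    & 2 - \sum_(t < l) lam t = 1].

Definition narrow_sets (k : nat) (C : 'I_k.+1 -> {set V}) (x : E -> R)
    (r : R) : {set {set V}} :=
  [set C i | i : 'I_k.+1 & weight x (cut (C i)) <= r].

Definition in_convex_hull (B : {set E} -> Prop) (y : E -> R) : Prop :=
  exists (n : nat) (c : 'I_n -> R) (T : 'I_n -> {set E}),
    [/\ forall i, 0 <= c i, \sum_(i < n) c i = 1, forall i, B (T i)
      & forall e, y e = \sum_(i < n) c i * (e \in T i)%:R].

Definition layered_convex_combination (k : nat) (C : 'I_k.+1 -> {set V})
    (x : E -> R) (l : nat) (lam : 'I_l -> R) (y : 'I_l -> E -> R) : Prop :=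
  (forall j, in_convex_hull (Gao_tree (narrow_sets C x (layer_value lam j)))
               (y j))
  /\ (forall e, x e = \sum_(j < l) lam j * y j e).

End Weights.
End Graph.

(* Main.v *)
Require Import Defs.
From mathcomp Require Import all_boot all_order all_algebra.
From mathcomp Require Import boolp reals.
From mathcomp Require Import zify ring lra.

(** The layers are peeled off one at a time.  Suppose that x has mass mu (it
    lies in mu times the spanning tree polytope) and that all cuts of the
    current chain have weight at most 2 mu - lam.  Then x = lam y + z, where y
    is a convex combination of Gao-trees and z has mass mu - lam.  Gao-trees
    have weight 1 on each cut of the chain and the right degree sums between
    two members of the chain, so z satisfies the same hypotheses for the chain
    of the cuts of weight less than 2 mu - lam.

    The Gao-trees of a chain are the bases of a matroid: the direct sum of the
    graphic matroids of the levels and of the rank one matroids on the edges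
    between consecutive levels.  With r1 its rank function and r the graphic
    rank function, Farkas' lemma and the greedy algorithm reduce the splitting
    of x to x(F) <= lam r1(F) + (mu - lam) r(F) for all edge sets F.  Let F be
    a largest violator.  Every interval M of levels satisfies
    x(E(M)) >= mu |M| - 2 mu + lam, so by submodularity each component of F
    meets each level in a connected piece, and F has an edge between two
    consecutive levels whenever one of its components meets both; otherwise F
    could be enlarged by some E(M).  The edges of such an F are charged to the
    gaps between levels that they cross.  Call a gap tight if F has an edge
    joining its two sides and only one component of F reaches its upper side
    from below: the edges that cross only tight gaps cost mu per gap, and
    every other edge is charged to the last gap it crosses that is not
    tight. *)

Set Implicit Arguments.
Unset Strict Implicit.
Unset Printing Implicit Defensive.

Import Order.TTheory GRing.Theory Num.Theory.

Local Open Scope ring_scope.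

(** * Linear separation *)

Section Farkas.
Variables (R : realFieldType) (I J : finType).
Implicit Types (a : J -> I -> R) (c d w : I -> R) (P Q : {set J}).

Definition dotprod c w : R := \sum_i c i * w i.

Lemma dotprodBl c d (z : R) w :
  dotprod (fun i => c i - z * d i) w = dotprod c w - z * dotprod d w.
Proof.
by rewrite /dotprod mulr_sumr -sumrB; apply: eq_bigr => i _; ring.
Qed.

Lemma dotprodBr c w (z : R) d :
  dotprod c (fun i => w i - z * d i) = dotprod c w - z * dotprod c d.
Proof.
by rewrite /dotprod mulr_sumr -sumrB; apply: eq_bigr => i _; ring.
Qed.

Lemma dotprodZr c (z : R) w : dotprod c (fun i => z * w i) = z * dotprod c w.
Proof. by rewrite /dotprod mulr_sumr; apply: eq_bigr => i _; ring. Qed.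

Lemma dotprod_le0_eq0 c : dotprod c c <= 0 -> forall i, c i = 0.
Proof.
have sq_ge0 i : true -> 0 <= c i * c i by rewrite -expr2 sqr_ge0.
move=> cc i; have : dotprod c c == 0 by rewrite eq_le cc sumr_ge0.
rewrite psumr_eq0 // => /allP/(_ i); rewrite mem_index_enum mulf_eq0 orbb.
by move=> /(_ isT)/eqP.
Qed.

Definition in_cone a P c := exists2 q : J -> R, (forall j, 0 <= q j) &
  forall i, c i = \sum_(j in P) q j * a j i.

Lemma in_coneS a P Q c : P \subset Q -> in_cone a P c -> in_cone a Q c.
Proof.
move=> PQ [q q0 cq]; exists (fun j => if j \in P then q j else 0) => [j|i].
  by case: ifP.
rewrite (big_setID P) /= (setIidPr PQ) [X in _ + X]big1 ?addr0 => [|j].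
  by rewrite cq; apply: eq_bigr => j ->.
by rewrite inE => /andP[/negPf-> _]; rewrite mul0r.
Qed.

Lemma in_cone_shear a P c j (alpha : J -> R) (gamma : R) :
  j \in P -> (forall k, k \in P :\ j -> alpha k <= 0) -> 0 <= gamma ->
  in_cone (fun k i => a k i - alpha k * a j i) (P :\ j)
    (fun i => c i - gamma * a j i) ->
  in_cone a P c.
Proof.
move=> jP alpha_le0 gamma_ge0 [q q0 cq].
pose qj := gamma - \sum_(k in P :\ j) q k * alpha k.
exists (fun k => if k == j then qj else q k) => [k|i].
  case: eqP => // _; rewrite subr_ge0 (le_trans _ gamma_ge0) // sumr_le0 //.
  by move=> l lP; rewrite mulr_ge0_le0 // alpha_le0.
rewrite (big_setD1 j) //= eqxx.
have -> : \sum_(k in P :\ j) (if k == j then qj else q k) * a k i =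
    \sum_(k in P :\ j) q k * a k i.
  by apply: eq_bigr => k; rewrite !inE => /andP[/negPf->].
have := cq i; under eq_bigr do rewrite mulrBr mulrA.
rewrite sumrB -mulr_suml => /eqP; rewrite subr_eq => /eqP ->.
by rewrite /qj; ring.
Qed.

(* Bartl's induction: if the generator j is indispensable, some z makes it
   positive while the target is positive and the other generators nonpositive;
   all vectors are then projected along a j so as to vanish on z. *)
Lemma farkas a P c :
  (forall w, (forall j, j \in P -> dotprod (a j) w <= 0) -> dotprod c w <= 0) ->
  in_cone a P c.
Proof.
have [n] := ubnP #|P|; elim: n a P c => // n IHn a P c Pn ac.
have [P0|[j jP]] := set_0Vmem P.
  exists (fun=> 0) => // i; rewrite P0 big_set0; apply: dotprod_le0_eq0.
  by apply: ac => k; rewrite P0 inE.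
have {}Pn : (#|P :\ j| < n)%N by move: Pn; rewrite (cardsD1 j) jP.
have [ac'|/existsNP[z0 /not_implyP[z0P /negP]]] := pselect (forall w,
    (forall k, k \in P :\ j -> dotprod (a k) w <= 0) -> dotprod c w <= 0).
  by apply: in_coneS (subsetDl _ _) (IHn _ _ _ Pn ac').
rewrite -ltNge => cz0.
have jz0 : 0 < dotprod (a j) z0.
  rewrite ltNge; apply: contraTN cz0 => jz0; rewrite -leNgt; apply: ac => k kP.
  by have [->//|kj] := eqVneq k j; apply: z0P; rewrite !inE kj.
pose z i := (dotprod (a j) z0)^-1 * z0 i.
have jz : dotprod (a j) z = 1 by rewrite dotprodZr mulVf ?gt_eqF.
apply: (@in_cone_shear a P c j (fun k => dotprod (a k) z) (dotprod c z)) => //.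
- by move=> k kP; rewrite dotprodZr pmulr_rle0 ?invr_gt0 ?z0P.
- by rewrite dotprodZr mulr_ge0 ?invr_ge0 ?(ltW jz0) ?(ltW cz0).
apply: IHn => // w aw.
have := ac (fun i => w i - dotprod (a j) w * z i).
rewrite dotprodBr dotprodBl [_ * dotprod c z]mulrC; apply => k kP.
rewrite dotprodBr; have [->|kj] := eqVneq k j; first by rewrite jz mulr1 subrr.
by have := aw k; rewrite dotprodBl [dotprod (a j) w * _]mulrC !inE kj; apply.
Qed.

End Farkas.

(* Farkas' lemma, homogenized by one extra coordinate. *)
Lemma convex_hull_separation (R : realFieldType) (I J : finType) (P : {set J})
    (p : J -> I -> R) (x : I -> R) :
  (forall w t, (forall j, j \in P -> dotprod (p j) w <= t) ->
     dotprod x w <= t) ->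
  exists c : J -> R, [/\ forall j, 0 <= c j, \sum_(j in P) c j = 1
    & forall i, x i = \sum_(j in P) c j * p j i].
Proof.
move=> xp; pose hom (u : I -> R) o := if o is Some i then u i else 1.
have homE u (w : option I -> R) :
    dotprod (hom u) w = w None + dotprod u (fun i => w (Some i)).
  rewrite /dotprod (bigD1 None) //= mul1r; congr (_ + _).
  rewrite (reindex_omap Some id) => [|[]//] /=.
  by apply: eq_bigl => i; rewrite eqxx.
have [w pw|c c0 xc] := @farkas _ _ _ (fun j => hom (p j)) P (hom x).
  rewrite homE -lerBrDl sub0r; apply: xp => j /pw.
  by rewrite homE -lerBrDl sub0r.
exists c; split=> // [|i]; last exact: (xc (Some i)).
by have := xc None; rewrite /= => ->; apply: eq_bigr => j _; rewrite mulr1.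
Qed.

(** * Matroids and the greedy algorithm *)

Lemma finset_ind (T : finType) (P : {set T} -> Prop) :
  P set0 -> (forall e (A : {set T}), e \notin A -> P A -> P (e |: A)) ->
  forall A, P A.
Proof.
move=> P0 PU A; have [n] := ubnP #|A|; elim: n A => // n IHn A An.
have [->//|[e eA]] := set_0Vmem A; rewrite -(setD1K eA).
apply: PU; first by rewrite !inE eqxx.
by apply: IHn; move: An; rewrite (cardsD1 e) eA.
Qed.

Section MatroidRank.
Variable E : finType.
Implicit Types (r : {set E} -> nat) (A B S T : {set E}) (s : seq E).
Local Open Scope nat_scope.

Definition diminishing_returns r := forall A B e, A \subset B ->
  r (e |: B) + r A <= r B + r (e |: A).

Definition matroid_rank r := [/\ r set0 = 0,
  forall A e, r A <= r (e |: A) <= (r A).+1 & diminishing_returns r].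

Definition matroid_base r T := (r T == #|T|) && (#|T| == r setT).

Lemma diminishing_returns_submodular r A B : diminishing_returns r ->
  r (A :|: B) + r (A :&: B) <= r A + r B.
Proof.
move=> rd; suff rU S : S \subset B ->
    r (A :|: S) + r (A :&: B) <= r A + r (A :&: B :|: S).
  by have := rU B (subxx B); rewrite (setUidPr (subsetIr A B)).
elim/finset_ind: S => [|e S _ IHS]; first by rewrite !setU0.
rewrite subUset => /andP[_ /IHS]; rewrite setUCA [_ :|: (e |: S)]setUCA.
have := rd (A :&: B :|: S) (A :|: S) e (setSU S (subsetIl A B)); lia.
Qed.

Section Matroid.
Variable r : {set E} -> nat.
Hypothesis rM : matroid_rank r.

Lemma matroid_rankU A B : r B <= r (A :|: B) <= r B + #|A|.
Proof.
have [_ r1 _] := rM; elim/finset_ind: A => [|e A eA IHA].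
  by rewrite set0U cards0 addn0 leqnn.
by rewrite -setUA cardsU1 eA; have := r1 (A :|: B) e; lia.
Qed.

Lemma matroid_rankS A B : A \subset B -> r A <= r B.
Proof. by move=> /setUidPl <-; have /andP[] := matroid_rankU B A. Qed.

Lemma matroid_rank_le_card A : r A <= #|A|.
Proof.
have [r0 _ _] := rM; have := matroid_rankU A set0.
by rewrite setU0 r0 => /andP[].
Qed.

Lemma matroid_base_cardI T S : matroid_base r T -> #|T :&: S| <= r S.
Proof.
move=> /andP[/eqP rT _]; have := matroid_rankU (T :\: S) (T :&: S).
have := matroid_rankS (subsetIr T S).
by rewrite setUC setID rT -(cardsID S T); lia.
Qed.

Fixpoint greedy s : {set E} :=
  if s is e :: s' then
    if r [set:: s'] < r (e |: [set:: s']) then e |: greedy s' else greedy s'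
  else set0.

Lemma greedy_sub s : greedy s \subset [set:: s].
Proof.
elim: s => [|e s IHs] /=; first by rewrite sub0set.
rewrite set_cons; case: ifP => _; first by rewrite setUS.
exact: subset_trans IHs (subsetUr _ _).
Qed.

Lemma card_greedy s : uniq s -> #|greedy s| = r [set:: s].
Proof.
have [r0 r1 _] := rM; elim: s => [|e s IHs] /=.
  by rewrite set_nil cards0 r0.
move=> /andP[es /IHs IH]; rewrite set_cons.
have /andP[rle rlt] := r1 [set:: s] e.
case: ltnP => [re|re]; last by rewrite IH; apply/eqP; rewrite eqn_leq rle re.
have eG : e \notin greedy s.
  by apply: contra es => /(subsetP (greedy_sub s)); rewrite inE.
by rewrite cardsU1 eG IH add1n; apply/eqP; rewrite eqn_leq re rlt.
Qed.

Lemma rank_greedy s : uniq s -> r (greedy s) = #|greedy s|.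
Proof.
have [r0 _ rd] := rM; elim: s => [|e s IHs] /=; first by rewrite r0 cards0.
move=> /andP[es us]; case: ifP => [re|_]; last exact: IHs.
have := rd _ _ e (greedy_sub s); have := matroid_rank_le_card (e |: greedy s).
move: re; rewrite -card_greedy // IHs // cardsU1.
by case: (e \notin _) => /=; lia.
Qed.

Lemma greedyI_drop s i : uniq s ->
  greedy s :&: [set:: drop i s] = greedy (drop i s).
Proof.
elim: s i => [|e s IHs] i; first by rewrite /= set0I.
case: i => [|i] us; first by rewrite drop0; apply/setIidPl/greedy_sub.
move: us => /= /andP[es us]; case: ifP => _; rewrite ?IHs //.
rewrite setIUl IHs // (_ : _ :&: _ = set0) ?set0U //; apply/setP => f.
by rewrite !inE; apply/andP => -[/eqP-> /mem_drop]; apply/negP.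
Qed.

Lemma greedy_base s : uniq s -> s =i E -> matroid_base r (greedy s).
Proof.
move=> us sE; have sT : [set:: s] = setT by apply/setP => e; rewrite !inE sE.
by rewrite /matroid_base rank_greedy // card_greedy // sT !eqxx.
Qed.

Lemma card_greedyI_drop s i : uniq s ->
  #|greedy s :&: [set:: drop i s]| = r [set:: drop i s].
Proof. by move=> us; rewrite greedyI_drop // card_greedy ?drop_uniq. Qed.

End Matroid.
End MatroidRank.

Section MatroidConstructions.
Variable E : finType.
Implicit Types (e : E) (F G I : {set E}).
Local Open Scope nat_scope.

Lemma setU1I e F I : (e |: F) :&: I = if e \in I then e |: F :&: I else F :&: I.
Proof.
rewrite setIUl; case: ifP => eI; first by rewrite (setIidPl _) ?sub1set.
by rewrite (disjoint_setI0 _) ?set0U // disjoints1 eI.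
Qed.

Lemma matroid_rank_imset (T : finType) (f : E -> T) (r : {set T} -> nat) :
  matroid_rank r -> matroid_rank (fun F => r (f @: F)).
Proof.
case=> r0 r1 rd; split=> [|F e|F G e FG]; first by rewrite imset0.
- by rewrite imsetU1.
- by rewrite !imsetU1 rd // imsetS.
Qed.

Lemma matroid_rank_direct_sum (r1 r2 : {set E} -> nat) I :
  matroid_rank r1 -> matroid_rank r2 ->
  matroid_rank (fun F => r1 (F :&: I) + r2 (F :\: I)).
Proof.
move=> [r10 r1U r1d] [r20 r2U r2d]; split=> [|F e|F G e FG].
- by rewrite set0I set0D r10 r20.
- rewrite !setDE !setU1I inE; case: ifP => _ /=.
    by have := r1U (F :&: I) e; lia.
  by have := r2U (F :&: ~: I) e; lia.
- rewrite !setDE !setU1I inE; case: ifP => _ /=.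
    by have := r1d _ _ e (setSI I FG); lia.
  by have := r2d _ _ e (setSI (~: I) FG); lia.
Qed.

Lemma matroid_rank_partition (J : finType) (h : E -> J -> bool) :
  (forall e i j, h e i -> h e j -> i = j) ->
  matroid_rank (fun F => #|[set j | [exists e in F, h e j]]|).
Proof.
move=> h_uniq; pose N F := [set j | [exists e in F, h e j]].
have NU1 e F : N (e |: F) = [set j | h e j] :|: N F.
  apply/setP => j; rewrite !inE; apply/existsP/orP => [[f]|[ej|/existsP[f]]].
  - rewrite !inE => /andP[/predU1P[->|fF] fj]; [by left|right].
    by apply/existsP; exists f; rewrite fF.
  - by exists e; rewrite setU11.
  - by move=> /andP[fF fj]; exists f; rewrite setU1r.
have h_le1 e : #|[set j | h e j]| <= 1.
  by apply/card_le1_eqP => i j; rewrite !inE => ei ej; exact: h_uniq ej ei.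
split=> [|F e|F G e /subsetP FG]; rewrite -!/(N _).
- apply/eqP; rewrite cards_eq0; apply/eqP/setP => j; rewrite !inE.
  by apply/existsP => -[e]; rewrite inE.
- rewrite NU1 cardsU; have := h_le1 e.
  by have := subset_leq_card (subsetIl [set j | h e j] (N F)); lia.
- have NFG : N F \subset N G.
    apply/subsetP => j; rewrite !inE => /existsP[f /andP[/FG fG fj]].
    by apply/existsP; exists f; rewrite fG.
  rewrite !NU1 !cardsU.
  have := subset_leq_card (setIS [set j | h e j] NFG).
  have := subset_leq_card (subsetIl [set j | h e j] (N F)).
  have := subset_leq_card (subsetIl [set j | h e j] (N G)).
  lia.
Qed.

End MatroidConstructions.

(** * Sums of matroid base polytopes *)

Section Weights.
Variables (R : realType) (E : finType).
Implicit Types (x y : E -> R) (F G : {set E}).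

Lemma weightE x F : weight x F = \sum_e x e * (e \in F)%:R.
Proof.
rewrite /weight big_mkcond; apply: eq_bigr => e _.
by case: ifP; rewrite ?mulr1 ?mulr0.
Qed.

Lemma eq_weight x y F : x =1 y -> weight x F = weight y F.
Proof. by move=> xy; apply: eq_bigr. Qed.

Definition indicator F : E -> R := fun e => (e \in F)%:R.

Lemma weight_indicator F G : weight (indicator F) G = #|F :&: G|%:R.
Proof.
rewrite weightE -sum1_card natr_sum [RHS]big_mkcond /=.
by apply: eq_bigr => e _; rewrite inE -natrM mulnb; case: (_ && _).
Qed.

Lemma weightUI x F G :
  weight x (F :|: G) + weight x (F :&: G) = weight x F + weight x G.
Proof.
rewrite !weightE -!big_split; apply: eq_bigr => e _ /=; rewrite !inE.
by case: (e \in F); case: (e \in G); rewrite /=; lra.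
Qed.

Lemma weight_ge0 x F : (forall e, 0 <= x e) -> 0 <= weight x F.
Proof. by move=> x0; apply: sumr_ge0. Qed.

Lemma le_weight x F G : (forall e, 0 <= x e) ->
  F \subset G -> weight x F <= weight x G.
Proof.
move=> x0 FG.
by rewrite /weight [leRHS](big_setID F) (setIidPr FG) lerDl sumr_ge0.
Qed.

Lemma weight_scale (z : R) x F : weight (fun e => z * x e) F = z * weight x F.
Proof. by rewrite /weight mulr_sumr. Qed.

Lemma weight_sum (J : finType) (P : pred J) (x : J -> E -> R) F :
  weight (fun e => \sum_(j | P j) x j e) F = \sum_(j | P j) weight (x j) F.
Proof. exact: exchange_big. Qed.

Definition indicator_sum (J : finType) (a : J -> R) (T : J -> {set E}) e : R :=
  \sum_j a j * indicator (T j) e.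

Lemma weight_indicator_sum (J : finType) (a : J -> R) (T : J -> {set E}) F :
  weight (indicator_sum a T) F = \sum_j a j * #|T j :&: F|%:R.
Proof.
rewrite weight_sum; apply: eq_bigr => j _.
by rewrite weight_scale weight_indicator.
Qed.

End Weights.

Lemma sorted_suffix_sum_le (R : realDomainType) (E : Type) (w d : E -> R)
    (e0 : E) (s : seq E) :
  path (fun e f => w e <= w f) e0 s ->
  (forall i, 0 <= \sum_(e <- drop i s) d e) ->
  w e0 * \sum_(e <- s) d e <= \sum_(e <- s) w e * d e.
Proof.
elim: s e0 => [|e s IHs] e0 /=; first by move=> _ _; rewrite !big_nil mulr0.
move=> /andP[e0e es] d_ge0; rewrite !big_cons.
have := IHs e es (fun i => d_ge0 i.+1).
have := d_ge0 0%N; rewrite drop0 big_cons; move: e0e.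
move: (\sum_(j <- s) _ * _) (\sum_(j <- s) _) => S D; nra.
Qed.

Section BasePolytopes.
Variables (R : realType) (E : finType).

Lemma in_convex_hull_family (J : finType) (P : {set J}) (T : J -> {set E})
    (B : {set E} -> Prop) (c : J -> R) (y : E -> R) :
  (forall j, 0 <= c j) -> \sum_(j in P) c j = 1 ->
  (forall j, j \in P -> B (T j)) ->
  (forall e, y e = \sum_(j in P) c j * (e \in T j)%:R) -> in_convex_hull B y.
Proof.
move=> c0 c1 BT yE; exists #|P|, (c \o enum_val), (T \o enum_val).
split=> [i||i|e] /=.
- exact: c0.
- by rewrite -(big_enum_val c).
- exact/BT/enum_valP.
- by rewrite yE big_enum_val.
Qed.

Lemma dotprod_ge0_sorted (d w : E -> R) (s : seq E) :
  uniq s -> s =i E -> sorted (fun e f => w e <= w f) s ->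
  (forall i, 0 <= weight d [set:: drop i s]) -> weight d setT = 0 ->
  0 <= dotprod w d.
Proof.
move=> us sE sw d_ge0 dT.
have sumE i : weight d [set:: drop i s] = \sum_(e <- drop i s) d e.
  by rewrite big_uniq ?drop_uniq //=; apply: eq_bigl => e; rewrite inE.
have sT : [set:: s] = setT by apply/setP => e; rewrite !inE sE.
have -> : dotprod w d = \sum_(e <- s) w e * d e.
  by rewrite big_uniq //; apply: eq_bigl => e; rewrite sE.
have sum0 : \sum_(e <- s) d e = 0 by rewrite -[s in LHS]drop0 -sumE drop0 sT.
case: s sw d_ge0 sum0 {us sE sT} sumE => [|e0 s] sw d_ge0 sum0 sumE.
  by rewrite big_nil.
have wlow : path (fun e f => w e <= w f) e0 (e0 :: s) by rewrite /= lexx.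
have := @sorted_suffix_sum_le _ _ w d e0 _ wlow; rewrite sum0 mulr0; apply=> i.
by rewrite -sumE.
Qed.

Section MatroidFamily.
Variables (J : finType) (r : J -> {set E} -> nat) (a : J -> R) (x : E -> R).
Hypothesis r_matroid : forall j, matroid_rank (r j).
Hypothesis x_le : forall F, weight x F <= \sum_j a j * (r j F)%:R.
Hypothesis x_total : weight x setT = \sum_j a j * (r j setT)%:R.

(* The greedy bases of all the matroids are tight on every suffix of the edges
   sorted by increasing w, so jointly they weigh at least as much as x. *)
Lemma bases_dominate (w : E -> R) : exists T : {ffun J -> {set E}},
  (forall j, matroid_base (r j) (T j)) /\
  dotprod x w <= dotprod (indicator_sum a T) w.
Proof.
pose s := sort (fun e f => w e <= w f) (enum E).
have us : uniq s by rewrite sort_uniq enum_uniq.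
have sE : s =i E by move=> e; rewrite mem_sort mem_enum.
pose T := [ffun j => greedy (r j) s].
exists T; split=> [j|]; first by rewrite ffunE; exact: greedy_base.
pose d e := indicator_sum a T e - x e.
have dE F : weight d F = weight (indicator_sum a T) F - weight x F.
  exact: sumrB.
have TE i : weight (indicator_sum a T) [set:: drop i s] =
    \sum_j a j * (r j [set:: drop i s])%:R.
  rewrite weight_indicator_sum; apply: eq_bigr => j _.
  by rewrite ffunE card_greedyI_drop.
have sT : [set:: drop 0 s] = setT.
  by apply/setP => e; rewrite drop0 !inE sE.
rewrite -subr_ge0 (_ : _ - _ = dotprod w d); last first.
  by rewrite /dotprod -sumrB; apply: eq_bigr => e _; rewrite /d; ring.
apply: dotprod_ge0_sorted us sE _ _ _ => [|i|].
- by apply: sort_sorted => e f; exact: le_total.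
- by rewrite dE subr_ge0 TE x_le.
- by rewrite dE x_total -sT TE subrr.
Qed.

Lemma sum_base_polytopes : exists2 y : J -> E -> R,
  forall j, in_convex_hull (fun T => matroid_base (r j) T) (y j)
  & forall e, x e = \sum_j a j * y j e.
Proof.
pose bases :=
  [set T : {ffun J -> {set E}} | [forall j, matroid_base (r j) (T j)]].
have [w t|c [c0 c1 xE]] := @convex_hull_separation R E _ bases
    (fun T : {ffun J -> {set E}} => indicator_sum a T) x.
  have [T [T_base xT]] := bases_dominate w; move=> /(_ T) T_le.
  by apply: le_trans xT (T_le _); rewrite inE; apply/forallP.
exists (fun j e => \sum_(T in bases) c T * (e \in T j)%:R) => [j|e].
  by apply: in_convex_hull_family c0 c1 _ _ => // T; rewrite inE => /forallP.
rewrite xE; under [RHS]eq_bigr => j _ do rewrite mulr_sumr.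
rewrite exchange_big; apply: eq_bigr => T _; rewrite mulr_sumr.
by apply: eq_bigr => j _; rewrite mulrCA.
Qed.

End MatroidFamily.

End BasePolytopes.

(** * Graphic matroids *)

(* Graphs as sets of pairs, so that a virtual edge can join any two vertices. *)
Section Components.
Variable V : finType.
Implicit Types (A B : {set V * V}) (U : {set V}) (u v w : V).
Local Open Scope nat_scope.

Definition linked A u v := ((u, v) \in A) || ((v, u) \in A).
Definition conn A := connect (linked A).
(* A component is named by its canonical representative. *)
Definition component A := fingraph.root (linked A).
Definition ncomp A := n_comp (linked A) V.
Definition pair_rank A := #|V| - ncomp A.

Lemma conn_refl A v : conn A v v.
Proof. exact: connect0. Qed.

Lemma conn_sym A u v : conn A u v = conn A v u.
Proof. by apply: sym_connect_sym => a b; rewrite /linked orbC. Qed.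

Lemma conn_trans A u v w : conn A u v -> conn A v w -> conn A u w.
Proof. exact: connect_trans. Qed.

Lemma component_conn A u v : (component A u == component A v) = conn A u v.
Proof. exact: root_connect (@conn_sym A) u v. Qed.

Lemma conn_pair A p : p \in A -> conn A p.1 p.2.
Proof.
by move=> pA; apply: connect1; rewrite /linked -surjective_pairing pA.
Qed.

Lemma conn_const (T : eqType) (g : V -> T) A u v :
  (forall p, p \in A -> g p.1 = g p.2) -> conn A u v -> g u = g v.
Proof.
move=> gA uv; have : closed (linked A) [pred w | g w == g u].
  by move=> a b /orP[] /gA /= gab; rewrite !inE gab.
by move=> /closed_connect/(_ _ _ uv); rewrite !inE eqxx => /esym/eqP.
Qed.

Lemma conn_subset A B u v : A \subset B -> conn A u v -> conn B u v.
Proof.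
move=> /subsetP AB uv; rewrite -component_conn; apply/eqP.
apply: conn_const uv => p /AB pB; apply/eqP.
by rewrite component_conn conn_pair.
Qed.

Lemma card_imset_le_ncomp (T : finType) (g : V -> T) A :
  (forall p, p \in A -> g p.1 = g p.2) -> #|g @: setT| <= ncomp A.
Proof.
move=> gA; apply: leq_trans (leq_imset_card g _); apply: subset_leq_card.
apply/subsetP => _ /imsetP[v _ ->]; apply/imsetP; exists (component A v).
  by rewrite !inE roots_root //; exact: (@conn_sym A).
by apply: conn_const gA _; exact: connect_root.
Qed.

Lemma ncomp_le_card_imset (T : finType) (g : V -> T) A :
  (forall u v, g u = g v -> conn A u v) -> ncomp A <= #|g @: setT|.
Proof.
move=> gA; rewrite /ncomp /n_comp_mem -(@card_in_imset _ _ g).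
  by apply: subset_leq_card; apply: imsetS; exact/subsetP.
move=> u v /andP[/eqP ru _] /andP[/eqP rv _] /gA.
rewrite -component_conn => /eqP.
by rewrite /component ru rv.
Qed.

Lemma ncompE A : ncomp A = #|component A @: setT|.
Proof.
apply/eqP; rewrite eqn_leq; apply/andP; split.
  by apply: ncomp_le_card_imset => u v /eqP; rewrite component_conn.
apply: card_imset_le_ncomp => p pA.
by apply/eqP; rewrite component_conn conn_pair.
Qed.

Definition merge A a b v := component A (if conn A b v then a else v).

Lemma conn_merge A a b v : conn ((a, b) |: A) v (merge A a b v).
Proof.
have ab : conn ((a, b) |: A) a b.
  by apply: (@conn_pair _ (a, b)); rewrite setU11.
have AU := @conn_subset A ((a, b) |: A) _ _ (subsetUr _ _).
apply: conn_trans (AU _ _ (connect_root _ _)); case: ifP => [bv|_].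
  by rewrite conn_sym; apply: conn_trans ab (AU _ _ bv).
exact: conn_refl.
Qed.

Lemma merge_edge A a b p :
  p \in (a, b) |: A -> merge A a b p.1 = merge A a b p.2.
Proof.
rewrite /merge => /setU1P[->|pA] /=; first by rewrite conn_refl if_same.
have -> : conn A b p.1 = conn A b p.2.
  exact: same_connect_r (@conn_sym A) _ _ (conn_pair pA) _.
by case: ifP => // _; apply/eqP; rewrite component_conn conn_pair.
Qed.

Lemma ncompU1 A a b : ~~ conn A a b -> ncomp A = (ncomp ((a, b) |: A)).+1.
Proof.
move=> ab; have -> : ncomp ((a, b) |: A) = #|merge A a b @: setT|.
  apply/eqP; rewrite eqn_leq (card_imset_le_ncomp (@merge_edge A a b)) andbT.
  apply: ncomp_le_card_imset => u v uv.
  apply: conn_trans (conn_merge A a b u) _.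
  by rewrite uv conn_sym conn_merge.
have b_merged : component A b \notin merge A a b @: setT.
  apply/imsetP => -[v _ /eqP]; rewrite component_conn; case: ifP => [_|->//].
  by rewrite conn_sym; apply/negP.
have := cardsU1 (component A b) (merge A a b @: setT).
rewrite b_merged /= add1n => <-.
rewrite ncompE; congr (#|pred_of_set _|); apply/setP => c; rewrite !inE.
apply/imsetP/predU1P => [[v _ ->]|[->|/imsetP[v _ ->]]]; last 2 first.
- by exists b.
- by exists (if conn A b v then a else v).
have [bv|bv] := boolP (conn A b v); [left|right].
  by apply/eqP; rewrite component_conn conn_sym.
by apply/imsetP; exists v; rewrite // /merge ifN.
Qed.

Lemma pair_rank_ncomp A : pair_rank A + ncomp A = #|V|.
Proof. by rewrite subnK // max_card. Qed.

Lemma pair_rank_conn A B :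
  (forall p, p \in A -> conn B p.1 p.2) -> pair_rank A <= pair_rank B.
Proof.
move=> AB; rewrite leq_sub2l // ncompE card_imset_le_ncomp // => p /AB.
by rewrite -component_conn => /eqP.
Qed.

Lemma pair_rankS A B : A \subset B -> pair_rank A <= pair_rank B.
Proof. by move=> AB; apply: pair_rank_conn => p /(subsetP AB)/conn_pair. Qed.

Lemma pair_rankU1 A p : pair_rank (p |: A) = pair_rank A + ~~ conn A p.1 p.2.
Proof.
case: p => a b /=; have [ab|ab] := boolP (conn A a b).
  rewrite addn0; apply/eqP; rewrite eqn_leq.
  rewrite [X in _ && X]pair_rankS ?subsetUr // andbT.
  by apply: pair_rank_conn => p /setU1P[->|/conn_pair].
apply: (@addIn (ncomp ((a, b) |: A))).
by rewrite addn1 addSnnS -ncompU1 // !pair_rank_ncomp.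
Qed.

Lemma pair_rank_matroid : matroid_rank pair_rank.
Proof.
split=> [|A p|A B p AB]; last 1 first.
- rewrite !pair_rankU1; have := @conn_subset A B p.1 p.2 AB.
  case: (conn A _ _) => [->//|_]; first by rewrite !addn0.
  by case: (conn B _ _) => /=; lia.
- apply/eqP; rewrite subn_eq0; have := @card_imset_le_ncomp _ id set0.
  by rewrite imset_id cardsT; apply=> p; rewrite inE.
- by rewrite pair_rankU1; case: conn => /=; lia.
Qed.

Lemma pair_rank_fibers (T : finType) (f : V -> T) U A :
  (forall p, p \in A -> [/\ p.1 \in U, p.2 \in U & f p.1 = f p.2]) ->
  pair_rank A + #|f @: U| <= #|U|.
Proof.
move=> fA; pose g v : V + T := if v \in U then inr (f v) else inl v.
have gE : g @: setT = (inl @: (~: U)) :|: inr @: (f @: U).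
  apply/setP => y; rewrite inE; apply/imsetP/orP => [[v _ ->]|].
    rewrite /g; case: ifP => vU; [right|left]; rewrite ?imset_f //.
    by rewrite inE vU.
  case=> [/imsetP[v vU ->]|/imsetP[_ /imsetP[v vU ->] ->]]; exists v => //.
    by rewrite inE in vU; rewrite /g (negPf vU).
  by rewrite /g vU.
have : #|~: U| + #|f @: U| <= ncomp A.
  rewrite -(card_imset (~: U) (@inl_inj V T)).
  rewrite -(card_imset (f @: U) (@inr_inj V T)).
  rewrite -cardsUI -gE (_ : _ :&: _ = set0) ?cards0 ?addn0.
    by apply: card_imset_le_ncomp => p /fA[]; rewrite /g => -> -> ->.
  by apply/setP => y; rewrite !inE; apply/andP => -[/imsetP[? _ ->] /imsetP[]].
have := pair_rank_ncomp A; have := cardsC U; lia.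
Qed.

End Components.

Section GraphicRank.
Variables (V E : finType) (ends : E -> V * V).
Implicit Types (F G : {set E}) (U : {set V}).

Lemma joins_conn e p q (B : {set V * V}) :
  joins ends e p q -> ends e \in B -> conn B p q.
Proof. by case/orP => /eqP-> /conn_pair //; rewrite conn_sym. Qed.

Lemma joins_conn_end e p q (B : {set V * V}) :
  joins ends e p q -> ends e \in B -> conn B (ends e).1 p.
Proof.
move=> /orP[/eqP-> _|/eqP eqp eB]; first exact: conn_refl.
by have := conn_pair eB; rewrite eqp.
Qed.

Definition graphic_rank F := pair_rank (ends @: F).

Lemma graphic_rank_matroid : matroid_rank graphic_rank.
Proof. exact: matroid_rank_imset (@pair_rank_matroid V). Qed.

Lemma mem_induced U e :
  (e \in induced_edges ends U) = ((ends e).1 \in U) && ((ends e).2 \in U).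
Proof. by rewrite inE orbb. Qed.

Lemma pair_rank_lt_card U (A : {set V * V}) : U != set0 ->
  (forall p, p \in A -> (p.1 \in U) && (p.2 \in U)) -> (pair_rank A < #|U|)%N.
Proof.
move=> /set0Pn[u uU] AU; have := @pair_rank_fibers _ unit (fun=> tt) U A.
rewrite (_ : (fun=> tt) @: U = [set tt]) ?cards1 ?addn1; last first.
  by apply/setP => -[]; rewrite inE eqxx; apply/imsetP; exists u.
by apply=> p /AU/andP[].
Qed.

Lemma graphic_rank_induced_lt U : U != set0 ->
  (graphic_rank (induced_edges ends U) < #|U|)%N.
Proof.
move=> /pair_rank_lt_card; apply=> _ /imsetP[e + ->].
by rewrite mem_induced.
Qed.

Lemma pair_rank_virtual_edge_lt U F u v :
  F \subset induced_edges ends U -> u \in U -> v \in U ->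
  (pair_rank ((u, v) |: ends @: F) < #|U|)%N.
Proof.
move=> /subsetP FU uU vU; apply: pair_rank_lt_card => [|p].
  by apply/set0Pn; exists u.
case/setU1P => [->|/imsetP[e /FU + ->]]; first by rewrite uU.
by rewrite mem_induced.
Qed.

Lemma graphic_rank_disconnected U F u v :
  F \subset induced_edges ends U -> u \in U -> v \in U ->
  ~~ conn (ends @: F) u v -> ((graphic_rank F).+1 < #|U|)%N.
Proof.
move=> FU uU vU uvF; have := pair_rank_virtual_edge_lt FU uU vU.
by rewrite pair_rankU1 uvF addn1.
Qed.

(* The pair (u, v) acts as a virtual edge, spanned by F but not by the part of
   F inside U; it makes the submodular inequality strict. *)
Lemma graphic_rank_augment U F u v (I := induced_edges ends U) :
  u \in U -> v \in U ->
  conn (ends @: F) u v -> ~~ conn (ends @: (F :&: I)) u v ->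
  (graphic_rank (F :|: I) + (graphic_rank (F :&: I)).+1
     < graphic_rank F + #|U|)%N.
Proof.
move=> uU vU uvF uvD; rewrite /graphic_rank; set D := F :&: I in uvD *.
pose plus (G : {set E}) := (u, v) |: ends @: G.
have plusI_lt : (pair_rank (plus I) < #|U|)%N.
  exact: pair_rank_virtual_edge_lt.
have plusF : pair_rank (plus F) = pair_rank (ends @: F).
  by rewrite pair_rankU1 uvF addn0.
have plusD : pair_rank (plus D) = (pair_rank (ends @: D)).+1.
  by rewrite pair_rankU1 uvD addn1.
have [_ _ rd] := @pair_rank_matroid V.
have := diminishing_returns_submodular (plus F) (plus I) rd.
have : (pair_rank (plus D) <= pair_rank (plus F :&: plus I))%N.
  by apply: pair_rankS; rewrite subsetI !setUS ?imsetS ?subsetIl ?subsetIr.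
have : (pair_rank (ends @: (F :|: I)) <= pair_rank (plus F :|: plus I))%N.
  by apply: pair_rankS; rewrite imsetU setUSS // subsetUr.
by rewrite plusD; move: plusI_lt plusF; clear; lia.
Qed.

Variable R : realType.

Lemma weight_le_graphic_rank (mu : R) (x : E -> R) F : (forall e, 0 <= x e) ->
  (forall U, U != set0 ->
     weight x (induced_edges ends U) <= mu * (#|U|%:R - 1)) ->
  weight x F <= mu * (graphic_rank F)%:R.
Proof.
move=> x0 xU; set A := ends @: F.
pose K := component A @: setT; pose block c := [set v | component A v == c].
have card_blocks : (\sum_(c in K) #|block c|)%N = #|V|.
  have imK v : v \in V -> component A v \in K by move=> _; rewrite imset_f.
  rewrite -[RHS]sum1_card [RHS](partition_big _ (mem K) imK) /=.
  apply: eq_bigr => c _; rewrite -sum1_card.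
  by apply: eq_bigl => v; rewrite inE.
have -> : (graphic_rank F)%:R = \sum_(c in K) (#|block c|%:R - 1) :> R.
  rewrite sumrB sumr_const -natr_sum card_blocks.
  by rewrite -(pair_rank_ncomp A) ncompE natrD addrK.
have imK e : e \in F -> component A (ends e).1 \in K.
  by move=> _; rewrite imset_f.
rewrite mulr_sumr /weight (partition_big _ (mem K) imK) /=.
apply: ler_sum => c /imsetP[v _ cE].
have /xU : block c != set0 by apply/set0Pn; exists v; rewrite inE cE.
apply: le_trans; pose Fc := [set e in F | component A (ends e).1 == c].
rewrite (eq_bigl (mem Fc)) => [|e]; last by rewrite /= inE.
apply: (@le_weight R E x) => //; apply/subsetP => e.
rewrite inE => /andP[eF ec].
rewrite mem_induced !inE ec -(eqP ec) eq_sym component_conn.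
exact: conn_pair (imset_f ends eF).
Qed.

End GraphicRank.

(** * The matroid of a levelled graph *)

Section LayeredRank.
Variables (V E : finType) (ends : E -> V * V) (K : nat) (lev : V -> 'I_K.+1).
Implicit Types (e : E) (F : {set E}) (U : {set V}) (t : nat).
Local Open Scope nat_scope.

Definition low e : nat := minn (lev (ends e).1) (lev (ends e).2).
Definition high e : nat := maxn (lev (ends e).1) (lev (ends e).2).

Definition inner := [set e | low e == high e].
(* Gap t lies between the levels t and t.+1. *)
Definition crosses e t := low e <= t < high e.
Definition is_step e t := (low e == t) && (high e == t.+1).
Definition has_step F t := [exists e in F, is_step e t].
Definition step_count F := #|[set t : 'I_K | has_step F t]|.

(* The direct sum of the graphic matroids of the levels and of the rank one
   matroids on the edges between consecutive levels; every other edge is a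
   loop. *)
Definition layered_rank F := graphic_rank ends (F :&: inner) + step_count F.

Lemma innerE e : (e \in inner) = (lev (ends e).1 == lev (ends e).2).
Proof. by rewrite inE /low /high -val_eqE /=; lia. Qed.

Lemma low_high_ends e : exists u v,
  [/\ joins ends e u v, lev u = low e :> nat & lev v = high e :> nat].
Proof.
rewrite /joins /low /high; case: (ends e) => a b /=.
by case: leqP => ab; [exists a, b|exists b, a]; rewrite eqxx ?orbT.
Qed.

Lemma high_le e : high e <= K.
Proof. by rewrite geq_max; apply/andP; split; rewrite -ltnS. Qed.

Lemma has_stepP F t :
  reflect (exists2 e, e \in F & is_step e t) (has_step F t).
Proof. exact: exists_inP. Qed.

Lemma has_step_setD F t : has_step (F :\: inner) t = has_step F t.
Proof.
apply/has_stepP/has_stepP => -[e eF et]; exists e => //.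
  by case/setDP: eF.
by move: et; rewrite !inE eF andbT /is_step; lia.
Qed.

Lemma layered_rank_matroid : matroid_rank layered_rank.
Proof.
have -> : layered_rank =
    fun F => graphic_rank ends (F :&: inner) + step_count (F :\: inner).
  apply/funext => F; congr (_ + #|pred_of_set _|); apply/setP => t.
  by rewrite !inE has_step_setD.
apply: (@matroid_rank_direct_sum _ (graphic_rank ends) step_count).
  exact: graphic_rank_matroid.
apply: matroid_rank_partition => e i j /andP[/eqP ei _] /andP[/eqP ej _].
by apply: ord_inj; rewrite -ei.
Qed.

Lemma graphic_rank_le_layered F : F \subset inner ->
  graphic_rank ends F <= layered_rank F.
Proof. by move=> /setIidPl FI; rewrite /layered_rank FI leq_addr. Qed.

Lemma layered_rank_outer F : (forall e, e \in F -> low e < high e) ->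
  layered_rank F = step_count F.
Proof.
move=> F_outer; rewrite /layered_rank (_ : F :&: inner = set0).
  by have [-> _ _] := graphic_rank_matroid ends.
by apply/setP => e; rewrite !inE; apply/andP => -[/F_outer]; lia.
Qed.

Lemma layered_rank_crossing F t : (forall e, e \in F -> crosses e t) ->
  layered_rank F <= 1.
Proof.
move=> Ft; rewrite layered_rank_outer => [|e /Ft]; last first.
  by rewrite /crosses; lia.
apply/card_le1_eqP => i j; rewrite !inE.
move=> /has_stepP[e /Ft et /andP[eI eS]] /has_stepP[f /Ft ft /andP[fI fS]].
by apply: ord_inj; move: et ft; rewrite /crosses; lia.
Qed.

Lemma layered_rank_skip F : (forall e, e \in F -> (low e).+1 < high e) ->
  layered_rank F = 0.
Proof.
move=> F_skip; rewrite layered_rank_outer => [|e /F_skip/ltnW//].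
apply/eqP; rewrite cards_eq0; apply/eqP/setP => t; rewrite !inE.
by apply/has_stepP => -[e /F_skip + /andP[]]; lia.
Qed.

(* The least level of U is not the upper level of a step. *)
Lemma step_count_induced_lt U : U != set0 ->
  step_count (induced_edges ends U) < #|lev @: U|.
Proof.
move=> /set0Pn[u0 u0U].
have [v vU vmin] := arg_minnP (fun v => lev v : nat) u0U.
rewrite (cardsD1 (lev v)) imset_f // add1n ltnS.
rewrite /step_count -(card_imset _ (@lift_inj K.+1 ord0)).
apply: subset_leq_card; apply/subsetP => _ /imsetP[t + ->].
rewrite inE => /has_stepP[e]; rewrite mem_induced => /andP[e1 e2] et.
have [a [b [jab a_lo b_hi]]] := low_high_ends e.
have [aU bU] : a \in U /\ b \in U by move: e1 e2; case/orP: jab => /eqP->.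
move: et; rewrite /is_step -a_lo -b_hi => /andP[/eqP a_t /eqP b_t].
have lift_lev : lift ord0 t = lev b by apply: ord_inj; rewrite lift0.
rewrite !inE lift_lev imset_f // andbT; have := vmin a aU.
by apply: contraTneq => /(congr1 val) /=; lia.
Qed.

Lemma layered_rank_induced_lt U : U != set0 ->
  layered_rank (induced_edges ends U) < #|U|.
Proof.
move=> U0; have := step_count_induced_lt U0; rewrite /layered_rank.
set I := _ :&: _; suff : graphic_rank ends I + #|lev @: U| <= #|U| by lia.
apply: pair_rank_fibers => _ /imsetP[e + ->].
by rewrite inE mem_induced innerE => /andP[/andP[-> ->] /eqP].
Qed.

Lemma layered_rank_augment U F (I := induced_edges ends U) :
  U != set0 -> F :&: I \subset inner ->
  layered_rank (F :|: I) + graphic_rank ends (F :&: I) < layered_rank F + #|U|.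
Proof.
move=> U0 DI; have [_ _ rd] := layered_rank_matroid.
have := diminishing_returns_submodular F I rd.
have := layered_rank_induced_lt U0; have := graphic_rank_le_layered DI.
by rewrite -/I; lia.
Qed.

End LayeredRank.

(** * Tight gaps between consecutive levels *)

Section TightGaps.
Variables (V E : finType) (ends : E -> V * V) (K : nat) (lev : V -> 'I_K.+1).
Variable F : {set E}.
Implicit Types (e : E) (u v w p q : V) (t : nat).
Local Open Scope nat_scope.

Local Notation A := (ends @: F).
Local Notation inner := (inner ends lev).
Local Notation low := (low ends lev).
Local Notation high := (high ends lev).
Local Notation crosses := (crosses ends lev).
Local Notation is_step := (is_step ends lev).
Local Notation has_step := (has_step ends lev).
Local Notation joins := (joins ends).

Definition rising_components t := [set c | [exists v, exists u,
  [&& component A v == c, conn A v u, lev v == t.+1 :> nat & lev u <= t]]].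
Definition rise_count t := #|rising_components t|.
Definition tight t := has_step F t && (rise_count t == 1).
Definition tight_edges :=
  [set e in F | [forall t : 'I_K, crosses e t ==> tight t]].
Definition rising_edges t := [set e in F |
  crosses e t && (component A (ends e).1 \in rising_components t)].

Lemma rising_componentsP t c :
  reflect (exists v u, [/\ component A v = c, conn A v u, lev v = t.+1 :> nat
                         & lev u <= t]) (c \in rising_components t).
Proof.
rewrite inE; apply: (iffP existsP) => [[v /existsP[u]]|[v [u [<- vu vt ut]]]].
  by move=> /and4P[/eqP vc vu /eqP vt ut]; exists v, u.
by exists v; apply/existsP; exists u; rewrite eqxx vu vt eqxx.
Qed.

Definition component_levels : {set V * 'I_K.+1} :=
  [set (component A v, lev v) | v in setT].
Definition above_bottom : {set V * 'I_K.+1} :=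
  [set p : V * 'I_K.+1 | [exists u, (component A u == p.1) && (lev u < p.2)]].

Lemma card_component_levels_le :
  #|component_levels| <= ncomp (ends @: (F :&: inner)).
Proof.
apply: card_imset_le_ncomp => _ /imsetP[e /setIP[eF + ->]].
rewrite innerE => /eqP ->.
by congr (_, _); apply/eqP; rewrite component_conn conn_pair // imset_f.
Qed.

Lemma ncomp_le_card_bottom : ncomp A <= #|component_levels :\: above_bottom|.
Proof.
apply: leq_trans (leq_imset_card fst _); rewrite ncompE; apply: subset_leq_card.
apply/subsetP => _ /imsetP[v _ ->].
have [w /eqP wv wmin] := @arg_minnP _ v
  (fun w => component A w == component A v) (fun w => lev w : nat) (eqxx _).
apply/imsetP; exists (component A w, lev w) => //.
rewrite inE imset_f // andbT inE.
by apply/existsP => -[u /= /andP[+ uw]]; rewrite wv => /wmin; rewrite leqNgt uw.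
Qed.

Lemma sum_rise_count_le_card :
  \sum_(t < K) rise_count t <= #|component_levels :&: above_bottom|.
Proof.
rewrite -[leqRHS]sum1_card (partition_big snd xpredT) //= big_ord_recl /=.
rewrite (leq_trans _ (leq_addl _ _)) //; apply: leq_sum => t _.
rewrite sum1dep_card.
apply: leq_trans (leq_imset_card fst _); apply: subset_leq_card.
apply/subsetP => c /rising_componentsP[v [u [<- vu vt ut]]].
apply/imsetP; exists (component A v, lev v) => //.
rewrite !inE imset_f //= -val_eqE /= vt eqxx andbT.
by apply/existsP; exists u; rewrite eq_sym component_conn vu ltnS.
Qed.

Lemma sum_rise_count_rank :
  \sum_(t < K) rise_count t + graphic_rank ends (F :&: inner)
    <= graphic_rank ends F.
Proof.
have := cardsID above_bottom component_levels.
have := pair_rank_ncomp A; have := pair_rank_ncomp (ends @: (F :&: inner)).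
have := card_component_levels_le; have := ncomp_le_card_bottom.
have := sum_rise_count_le_card.
rewrite -!/(graphic_rank _ _).
move: (graphic_rank _ _) (graphic_rank _ F) (ncomp _) (ncomp A).
move: (\sum_(t < K) _); lia.
Qed.

Lemma step_ends e t : is_step e t ->
  exists p q, [/\ joins e p q, lev p = t :> nat & lev q = t.+1 :> nat].
Proof.
have [p [q [epq pt qt]]] := low_high_ends ends lev e.
by move=> /andP[/eqP lo_t /eqP hi_t]; exists p, q; rewrite pt qt.
Qed.

(* At most one component rises at a tight gap, and it contains the step. *)
Lemma tight_step_conn t u v e p q :
  tight t -> conn A v u -> lev v = t.+1 :> nat -> lev u <= t ->
  e \in F -> joins e p q -> lev p = t :> nat -> lev q = t.+1 :> nat ->
  conn A v q.
Proof.
move=> /andP[_ /cards1P[c rising_t]] vu vt ut eF epq pt qt.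
have qp : conn A q p by rewrite conn_sym; apply: joins_conn epq (imset_f _ eF).
have: component A v \in rising_components t.
  by apply/rising_componentsP; exists v, u.
have: component A q \in rising_components t.
  by apply/rising_componentsP; exists q, p; rewrite pt.
by rewrite rising_t !inE => /eqP<-; rewrite component_conn.
Qed.

Lemma tight_descend d t u v :
  conn A u v -> lev v = d :> nat -> lev u <= t <= d ->
  (forall s, t <= s < d -> tight s) -> exists2 w, conn A u w & lev w = t :> nat.
Proof.
elim: d v => [|d IHd] v uv vd utd tight_s; first by exists v; [|lia].
have [td|td] := eqVneq t d.+1; first by exists v; [|lia].
have tight_d : tight d by apply: tight_s; lia.
have /andP[/has_stepP[e eF /step_ends[p [q [epq pd qd]]]] _] := tight_d.
have ud : lev u <= d by lia.
have vq : conn A v q.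
  by apply: (tight_step_conn tight_d _ vd ud eF epq pd qd); rewrite conn_sym.
have qp : conn A q p by rewrite conn_sym; apply: joins_conn epq (imset_f _ eF).
apply: IHd (conn_trans uv (conn_trans vq qp)) pd _ _; first by lia.
by move=> s sd; apply: tight_s; lia.
Qed.

(* An edge that crosses a gap that is not tight is charged to the last such gap:
   since the gaps above are tight, its component comes down to that gap. *)
Lemma not_tight_edge e : e \in F -> e \notin tight_edges ->
  exists2 t : 'I_K, ~~ tight t & e \in rising_edges t.
Proof.
move=> eF; rewrite inE eF /= negb_forall => /existsP[t0].
rewrite negb_imply => t0P.
case: (@arg_maxnP _ t0 (fun t : 'I_K => crosses e t && ~~ tight t) val t0P).
move=> t /andP[et not_tight] tmax; exists t => //; rewrite inE eF et /=.
have [p [q [epq p_lo q_hi]]] := low_high_ends ends lev e.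
have pq : conn A p q := joins_conn epq (imset_f _ eF).
have /andP[lo_t t_hi] := et.
have [||w pw wt] := @tight_descend (high e) t.+1 p q pq q_hi; first by lia.
  move=> s sP; apply: contraT => not_tight_s.
  have sK : s < K by have := high_le ends lev e; lia.
  by have := tmax (Ordinal sK); rewrite not_tight_s /crosses /=; lia.
apply/rising_componentsP; exists w, p; rewrite wt p_lo conn_sym pw; split=> //.
apply/eqP; rewrite component_conn conn_sym.
by apply: conn_trans pw; apply: joins_conn_end epq (imset_f _ eF).
Qed.

Lemma tight_step_system : exists2 S : {set E},
  #|S| <= #|[set t : 'I_K | tight t]|
  & forall t : 'I_K, tight t -> exists2 e, e \in F :&: S & is_step e t.
Proof.
pose step_at (t : 'I_K) := [pick e in F | is_step e t].
pose tights := [set t : 'I_K | tight t].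
exists [set e | Some e \in step_at @: tights] => [|t tight_t].
  rewrite -(card_imset _ (@Some_inj _ : injective (@Some E))).
  apply: leq_trans (leq_imset_card step_at _).
  by apply: subset_leq_card; apply/subsetP => _ /imsetP[e + ->]; rewrite inE.
have /andP[/has_stepP[e0 e0F e0t] _] := tight_t.
case step_t: (step_at t) => [e|]; last first.
  by move: step_t; rewrite /step_at; case: pickP => // /(_ e0); rewrite e0F e0t.
have /andP[eF et] : (e \in F) && is_step e t.
  by move: step_t; rewrite /step_at; case: pickP => // f ft [<-].
exists e; rewrite // !inE eF; apply/imsetP.
by exists t; rewrite ?inE.
Qed.

Definition levels_connected := forall u v,
  lev u = lev v -> conn A u v -> conn (ends @: (F :&: inner)) u v.

Section LevelsConnected.
Hypothesis level_conn : levels_connected.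

Lemma tight_ascend (S : {set E}) d u v :
  (forall t : 'I_K, tight t -> exists2 e, e \in F :&: S & is_step e t) ->
  conn A u v -> lev v = d :> nat -> lev u <= d ->
  (forall s, lev u <= s < d -> tight s) ->
  conn (ends @: (F :&: inner :|: S)) u v.
Proof.
move=> S_steps; set B := ends @: (_ :|: _).
have level_connB a b : lev a = lev b :> nat -> conn A a b -> conn B a b.
  move=> /ord_inj ab /(level_conn ab); apply: conn_subset.
  by apply: imsetS; exact: subsetUl.
elim: d v => [|d IHd] v uv vd ud tight_s.
  by apply: level_connB => //; lia.
have [udE|ud_neq] := eqVneq (lev u : nat) d.+1.
  by apply: level_connB => //; rewrite udE.
have {}ud : lev u <= d by lia.
have dK : d < K by have := ltn_ord (lev v); lia.
have tight_d : tight d by apply: tight_s; lia.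
have [e /setIP[eF eS]] := S_steps (Ordinal dK) tight_d.
move=> /step_ends[p [q [epq pd qd]]].
have vu : conn A v u by rewrite conn_sym.
have vq := tight_step_conn tight_d vu vd ud eF epq pd qd.
have pqB : conn B p q.
  by apply: joins_conn epq (imset_f _ _); rewrite inE eS orbT.
have qp : conn A q p by rewrite conn_sym; apply: joins_conn epq (imset_f _ eF).
have upB : conn B u p.
  apply: IHd (conn_trans uv (conn_trans vq qp)) pd ud _ => s sd.
  by apply: tight_s; lia.
apply: conn_trans upB (conn_trans pqB _).
apply: level_connB; first by rewrite vd.
by rewrite conn_sym.
Qed.

Lemma tight_edges_rank : graphic_rank ends tight_edges <=
  graphic_rank ends (F :&: inner) + #|[set t : 'I_K | tight t]|.
Proof.
have [S S_le S_steps] := tight_step_system.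
have rM := graphic_rank_matroid ends.
apply: (@leq_trans (graphic_rank ends (F :&: inner :|: S))); last first.
  by have := matroid_rankU rM S (F :&: inner); rewrite setUC => /andP[_]; lia.
apply: pair_rank_conn => _ /imsetP[e + ->].
rewrite inE => /andP[eF /forallP tight_e].
have [p [q [epq p_lo q_hi]]] := low_high_ends ends lev e.
have pq : conn (ends @: (F :&: inner :|: S)) p q.
  apply: tight_ascend S_steps (joins_conn epq (imset_f _ eF)) q_hi _ _.
    by rewrite p_lo /low /high; lia.
  rewrite p_lo => s es; have sK : s < K by have := high_le ends lev e; lia.
  exact: (implyP (tight_e (Ordinal sK))).
by case/orP: epq pq => /eqP-> //=; rewrite conn_sym.
Qed.

End LevelsConnected.
End TightGaps.

(** * The rank inequality *)

Section RankInequality.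
Variables (R : realType) (V E : finType) (ends : E -> V * V).
Variables (K : nat) (lev : V -> 'I_K.+1) (x : E -> R) (mu lam : R).
Implicit Types (F G : {set E}) (u v : V).

Local Notation low := (low ends lev).
Local Notation high := (high ends lev).
Local Notation inner := (inner ends lev).
Local Notation crosses := (crosses ends lev).
Local Notation has_step := (has_step ends lev).
Local Notation layered_rank := (layered_rank ends lev).
Local Notation graphic_rank := (graphic_rank ends).
Local Notation induced := (induced_edges ends).

Definition level_interval a b := [set v | (a <= lev v < b)%N].

Hypothesis x_ge0 : forall e, 0 <= x e.
Hypothesis x_induced : forall U : {set V}, U != set0 ->
  weight x (induced U) <= mu * (#|U|%:R - 1).
Hypotheses (lam_gt0 : 0 < lam) (lam_le : lam <= mu).
Hypothesis x_cross : forall t : 'I_K,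
  weight x [set e | crosses e t] <= 2 * mu - lam.
Hypothesis x_skip : forall t : 'I_K, (0 < t)%N ->
  weight x [set e | (low e < t < high e)%N] <= mu - lam.
Hypothesis x_interval : forall a b, (a < b <= K.+1)%N ->
  mu * #|level_interval a b|%:R - 2 * mu + lam
    <= weight x (induced (level_interval a b)).

Let lam_ge0 : 0 <= lam. Proof. exact: ltW. Qed.
Let mu_lam_ge0 : 0 <= mu - lam. Proof. by rewrite subr_ge0. Qed.
Let mu_ge0 : 0 <= mu. Proof. exact: le_trans lam_le. Qed.

Let weight_le_rank F : weight x F <= mu * (graphic_rank F)%:R.
Proof. exact: weight_le_graphic_rank. Qed.

Definition rank_bound F : R :=
  lam * (layered_rank F)%:R + (mu - lam) * (graphic_rank F)%:R.

Section ClosedSet.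
Variable F : {set E}.
Local Notation A := (ends @: F).

Definition steps_present := forall u v,
  lev v = (lev u).+1 :> nat -> conn A u v -> has_step F (lev u).

Local Notation tight := (tight ends lev F).
Local Notation tight_edges := (tight_edges ends lev F).
Local Notation rising_edges := (rising_edges ends lev F).
Local Notation rise_count := (rise_count ends lev F).

Lemma has_step_rise_count t : has_step F t -> (0 < rise_count t)%N.
Proof.
move=> /has_stepP[e eF /step_ends[p [q [epq pt qt]]]].
rewrite card_gt0; apply/set0Pn; exists (component A q).
apply/rising_componentsP; exists q, p; rewrite pt qt conn_sym; split=> //.
exact: joins_conn epq (imset_f _ eF).
Qed.

Lemma rising_edge_rise_count t e : e \in rising_edges t -> (0 < rise_count t)%N.
Proof.
rewrite inE => /and3P[_ _ et]; rewrite card_gt0; apply/set0Pn.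
by exists (component A (ends e).1).
Qed.

Lemma rising_edge_skips t e : steps_present -> ~~ has_step F t ->
  e \in rising_edges t -> (low e < t < high e)%N.
Proof.
move=> steps no_step; rewrite inE => /and3P[eF /andP[lo_t ->]].
move=> /rising_componentsP[v [_ [/eqP + _ vt _]]]; rewrite component_conn => ve.
have [p [q [epq p_lo _]]] := low_high_ends ends lev e.
rewrite andbT ltn_neqAle lo_t andbT; apply: contra no_step => /eqP lo_tE.
have pv : conn A p v.
  rewrite conn_sym; apply: conn_trans ve _.
  exact: joins_conn_end epq (imset_f _ eF).
by have := steps p v; rewrite p_lo lo_tE vt; apply.
Qed.

Lemma weight_rising_edges (t : 'I_K) : steps_present -> ~~ tight t ->
  weight x (rising_edges t) <=
    lam * (has_step F t)%:R + (mu - lam) * (rise_count t)%:R.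
Proof.
move=> steps; rewrite /tight.
case: (boolP (has_step F t)) => [ht|no_step] not_tight.
  have rise2 : 2 <= (rise_count t)%:R :> R.
    rewrite ler_nat; have := has_step_rise_count ht.
    by move: not_tight => /=; lia.
  apply: (@le_trans _ _ (2 * mu - lam)).
    apply: le_trans (x_cross t); apply: le_weight => //.
    by apply/subsetP => e; rewrite !inE => /and3P[].
  by have := ler_wpM2l mu_lam_ge0 rise2; rewrite /=; lra.
rewrite mulr0 add0r; have [->|[e0 e0t]] := set_0Vmem (rising_edges t).
  by rewrite /weight big_set0 mulr_ge0.
apply: (@le_trans _ _ (mu - lam)); last first.
  by rewrite ler_peMr // ler1n (rising_edge_rise_count e0t).
have t_gt0 : (0 < t)%N.
  have /andP[low_lt _] := rising_edge_skips steps no_step e0t.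
  exact: leq_ltn_trans low_lt.
apply: le_trans (x_skip t_gt0); apply: le_weight => //; apply/subsetP => e et.
rewrite inE; exact: rising_edge_skips et.
Qed.

Lemma weight_le_tight_rising : weight x F <=
  weight x tight_edges + \sum_(t < K | ~~ tight t) weight x (rising_edges t).
Proof.
rewrite !weightE; under [X in _ <= _ + X]eq_bigr do rewrite weightE.
rewrite exchange_big -big_split /=; apply: ler_sum => e _.
have sum_ge0 (P : pred 'I_K) :
    0 <= \sum_(t < K | P t) x e * (e \in rising_edges t)%:R.
  by apply: sumr_ge0 => t _; rewrite mulr_ge0.
case: (boolP (e \in F)) => eF; last by rewrite mulr0 addr_ge0 // mulr_ge0.
case: (boolP (e \in tight_edges)) => e_tight; first by rewrite lerDl.
have [t not_tight et] := not_tight_edge eF e_tight.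
by rewrite mulr0 add0r (bigD1 t) //= et lerDl sum_ge0.
Qed.

Lemma weight_tight_edges : levels_connected ends lev F ->
  weight x tight_edges <=
    mu * (graphic_rank (F :&: inner))%:R + \sum_(t < K | tight t) mu.
Proof.
move=> /tight_edges_rank; rewrite -(ler_nat R) natrD => /(ler_wpM2l mu_ge0).
move=> /(le_trans (weight_le_rank _)).
rewrite mulrDr [mu * #|_|%:R]mulr_natr -sumr_const.
by rewrite [X in _ + X](eq_bigl (fun t : 'I_K => tight t)) // => t; rewrite inE.
Qed.

Lemma closed_rank_inequality :
  levels_connected ends lev F -> steps_present -> weight x F <= rank_bound F.
Proof.
move=> level_conn steps; apply: le_trans weight_le_tight_rising _.
have stepE : (step_count ends lev F)%:R = \sum_(t < K) (has_step F t)%:R :> R.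
  rewrite /step_count -sum1_card natr_sum big_mkcond; apply: eq_bigr => t _.
  by rewrite inE; case: has_step.
have gaps_le : \sum_(t < K | tight t) mu +
    \sum_(t < K | ~~ tight t) weight x (rising_edges t) <=
    lam * (step_count ends lev F)%:R +
    (mu - lam) * (\sum_(t < K) rise_count t)%:R.
  rewrite stepE natr_sum !mulr_sumr -big_split.
  rewrite [leRHS](bigID (fun t : 'I_K => tight t)) /=.
  apply: lerD; apply: ler_sum => t tight_t; last exact: weight_rising_edges.
  by move: tight_t => /andP[-> /eqP->]; rewrite !mulr1 addrC subrK.
have := sum_rise_count_rank ends lev F; rewrite -(ler_nat R) natrD.
move=> /(ler_wpM2l mu_lam_ge0); have := weight_tight_edges level_conn.
move: gaps_le; rewrite /rank_bound natrD.
move: (\sum_(t < K | tight t) _) (\sum_(t < K | ~~ tight t) _) => T N; lra.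
Qed.

End ClosedSet.

Definition violates F := rank_bound F < weight x F.

Lemma augment_violates F u v a b
    (M := level_interval a b) (D := F :&: induced M) :
  (a < b <= K.+1)%N -> D \subset inner -> u \in M -> v \in M ->
  conn (ends @: F) u v -> ~~ conn (ends @: D) u v ->
  violates F -> violates (F :|: induced M).
Proof.
move=> ab D_inner uM vM uvF uvD; rewrite /violates /rank_bound.
have M0 : M != set0 by apply/set0Pn; exists u.
have layered_le : (layered_rank (F :|: induced M))%:R + (graphic_rank D)%:R + 1
    <= (layered_rank F)%:R + #|M|%:R :> R.
  by rewrite -!natrD natr1 ler_nat layered_rank_augment.
have graphic_le : (graphic_rank (F :|: induced M))%:R + (graphic_rank D)%:R + 2
    <= (graphic_rank F)%:R + #|M|%:R :> R.
  by rewrite -!natrD ler_nat addn2 -addnS; exact: graphic_rank_augment uvD.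
have := ler_wpM2l lam_ge0 layered_le; have := ler_wpM2l mu_lam_ge0 graphic_le.
have := x_interval ab; have := weight_le_rank D.
have := weightUI x F (induced M).
by rewrite -/M -/D; lra.
Qed.

Lemma disconnected_interval u v a b (M := level_interval a b)
    (D : {set E}) :
  (a < b <= K.+1)%N -> D \subset induced M -> u \in M -> v \in M ->
  ~~ conn (ends @: D) u v -> weight x D < weight x (induced M).
Proof.
move=> ab DM uM vM uvD; apply: lt_le_trans (x_interval ab).
have : (graphic_rank D)%:R + 2 <= #|M|%:R :> R.
  by rewrite -natrD ler_nat addn2; exact: graphic_rank_disconnected uvD.
move=> /(ler_wpM2l mu_ge0); have := weight_le_rank D; rewrite -/M.
by move: lam_gt0; lra.
Qed.

Lemma max_violator_conn F u v a b (M := level_interval a b) :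
  violates F -> (forall G, violates G -> (#|G| <= #|F|)%N) ->
  (a < b <= K.+1)%N -> F :&: induced M \subset inner -> u \in M -> v \in M ->
  conn (ends @: F) u v -> conn (ends @: (F :&: induced M)) u v.
Proof.
move=> F_viol F_max ab D_inner uM vM uvF; apply: contraT => uvD.
have FE : F :|: induced M = F.
  apply/esym/eqP; rewrite eqEcard subsetUl F_max //.
  exact: augment_violates uvD F_viol.
have := disconnected_interval ab (subsetIr _ _) uM vM uvD.
by move/setUidPl/setIidPr: FE => ->; rewrite ltxx.
Qed.

Lemma rank_inequality F : weight x F <= rank_bound F.
Proof.
rewrite leNgt; apply/negP => F0_viol.
have [{F0_viol}F F_viol F_max] :=
  arg_maxnP (fun G : {set E} => #|G|) (F0_viol : (fun G => violates G) F).
have : ~~ violates F; last by rewrite F_viol.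
rewrite -leNgt; apply: closed_rank_inequality => [u v uv uvF|u v uv uvF].
  have D_inner : F :&: induced (level_interval (lev u) (lev u).+1)
      \subset F :&: inner.
    apply: setIS; apply/subsetP => e.
    rewrite mem_induced innerE !inE -val_eqE /=.
    by clear; lia.
  apply: conn_subset (imsetS ends D_inner) _; apply: max_violator_conn => //.
  - by rewrite ltnSn ltn_ord.
  - exact: subset_trans D_inner (subsetIr _ _).
  - by rewrite inE leqnn ltnSn.
  - by rewrite inE -uv leqnn ltnSn.
apply: contraT => no_step.
set M := level_interval (lev u) (lev u).+2.
have D_inner : F :&: induced M \subset inner.
  apply/subsetP => e; rewrite inE mem_induced innerE -val_eqE => /andP[eF eM].
  apply: contraNT no_step => e_outer; apply/has_stepP; exists e => //.
  by move: eM e_outer; rewrite /is_step /low /high !inE /=; clear; lia.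
have uvD : conn (ends @: (F :&: induced M)) u v.
  apply: max_violator_conn => //; rewrite ?inE ?uv ?leqnn ?leqnSn ?ltnS //.
  by rewrite -ltnS -uv ltn_ord.
suff uvE : lev u = lev v by move: uv; rewrite uvE; clear; lia.
apply: conn_const uvD => _ /imsetP[e /(subsetP D_inner) + ->].
by rewrite innerE => /eqP.
Qed.

End RankInequality.

(** * The scaled spanning tree polytope *)

Section CutIdentities.
Variables (R : realType) (V E : finType) (ends : E -> V * V).
Implicit Types (x : E -> R) (A B S : {set V}).

Local Notation induced := (induced_edges ends).
Local Notation cut := (cut ends).
Local Notation between := (edges_between ends).

Lemma weight_split x S :
  weight x setT =
  weight x (induced S) + weight x (induced (~: S)) + weight x (cut S).
Proof.
rewrite !weightE -!big_split; apply: eq_bigr => e _ /=; rewrite !inE.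
by case: (_ \in S); case: (_ \in S); rewrite /=; lra.
Qed.

Lemma weight_cut_setD x A B : A \subset B ->
  weight x (cut A) + weight x (cut B) =
  weight x (cut (B :\: A)) + 2 * weight x (between A (~: B)).
Proof.
move=> /subsetP AB; rewrite !weightE mulr_sumr -!big_split.
apply: eq_bigr => e _; rewrite /= !inE; case: (ends e) => u v /=.
have := AB v; have := AB u.
by case: (u \in A) => [/(_ isT)->|_]; case: (v \in A) => [/(_ isT)->|_];
   case: (u \in B); case: (v \in B) => /=; lra.
Qed.

Lemma weight_induced_setD x A B : A \subset B ->
  weight x (induced B) + weight x (between A (~: B)) =
  weight x (induced A) + weight x (induced (B :\: A)) + weight x (cut A).
Proof.
move=> /subsetP AB; rewrite !weightE -!big_split; apply: eq_bigr => e _.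
rewrite /= !inE; case: (ends e) => u v /=; have := AB v; have := AB u.
by case: (u \in A) => [/(_ isT)->|_]; case: (v \in A) => [/(_ isT)->|_];
   case: (u \in B); case: (v \in B) => /=; lra.
Qed.

Lemma cut_setC S : cut (~: S) = cut S.
Proof. by rewrite /Defs.cut setCK; apply/setP => e; rewrite !inE orbC. Qed.

Lemma induced_setT : induced setT = setT.
Proof. by apply/setP => e; rewrite mem_induced !inE. Qed.

End CutIdentities.

Lemma setC_neq0 (T : finType) (S : {set T}) : (~: S != set0) = (S != setT).
Proof. by rewrite -setCT (inj_eq (@setC_inj _)). Qed.

Lemma setC_neqT (T : finType) (S : {set T}) : (~: S != setT) = (S != set0).
Proof. by rewrite -setC0 (inj_eq (@setC_inj _)). Qed.

Section ScaledPolytope.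
Variables (R : realType) (V E : finType) (ends : E -> V * V).
Implicit Types (x : E -> R) (A B S U : {set V}) (T : {set E}).

Local Notation induced := (induced_edges ends).
Local Notation cut := (cut ends).

Definition in_scaled_polytope (mu : R) x : Prop :=
  [/\ forall e, 0 <= x e,
      forall U, U != set0 -> weight x (induced U) <= mu * (#|U|%:R - 1)
    & weight x setT = mu * (#|V|%:R - 1)].

Definition tree_point T : Prop := in_scaled_polytope 1 (indicator R T).

Lemma in_scaled_polytopeZ (z mu : R) x : 0 <= z ->
  in_scaled_polytope mu x -> in_scaled_polytope (z * mu) (fun e => z * x e).
Proof.
move=> z0 [x0 xU xT]; split=> [e|U U0|]; first by rewrite mulr_ge0.
  by rewrite weight_scale -mulrA ler_wpM2l // xU.
by rewrite weight_scale xT mulrA.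
Qed.

Section Point.
Variables (mu : R) (x : E -> R).
Hypothesis xP : in_scaled_polytope mu x.

Lemma polytope_loop e : (ends e).1 = (ends e).2 -> x e = 0.
Proof.
have [x0 xU _] := xP => ee; apply/eqP; rewrite eq_le x0 andbT.
have U0 : [set (ends e).1] != set0 by rewrite -card_gt0 cards1.
have := xU _ U0; rewrite cards1 subrr mulr0; apply: le_trans.
rewrite /weight (bigD1 e) /=; first by rewrite lerDl sumr_ge0.
by rewrite mem_induced -ee !inE eqxx.
Qed.

Lemma sum_degrees S : \sum_(v in S) weight x (cut [set v]) =
  2 * weight x (induced S) + weight x (cut S).
Proof.
under eq_bigr => v _ do rewrite weightE.
rewrite exchange_big !weightE mulr_sumr -big_split; apply: eq_bigr => e _ /=.
have [ee|ee] := eqVneq (ends e).1 (ends e).2.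
  rewrite (polytope_loop ee) big1 ?mul0r ?mulr0 ?addr0 // => v _.
  by rewrite mul0r.
have sum_eq (w : V) : \sum_(v in S) (v == w)%:R = (w \in S)%:R :> R.
  case: (boolP (w \in S)) => wS; last first.
    by rewrite big1 // => v vS; case: eqP wS => // <-; rewrite vS.
  rewrite (bigD1 w) //= eqxx big1 ?addr0 // => v /andP[_ vw].
  by rewrite (negPf vw).
rewrite (eq_bigr
  (fun v => x e * (v == (ends e).1)%:R + x e * (v == (ends e).2)%:R)).
  rewrite big_split -!mulr_sumr !sum_eq !inE.
  by case: (_ \in S); case: (_ \in S); rewrite /=; lra.
move=> v _; rewrite !inE ![_ == v]eq_sym.
have [v1|_] := eqVneq v (ends e).1; have [v2|_] := eqVneq v (ends e).2 => /=;
  try lra.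
by rewrite -v1 -v2 eqxx in ee.
Qed.

Lemma polytope_induced_ge S : S != set0 -> S != setT ->
  mu * #|S|%:R - weight x (cut S) <= weight x (induced S).
Proof.
have [_ xU xT] := xP => /xU + ; rewrite -setC_neq0 => + /xU.
have := weight_split ends x S.
by rewrite xT -(cardsC S) natrD; lra.
Qed.

Lemma polytope_cut_ge S : S != set0 -> S != setT -> mu <= weight x (cut S).
Proof.
have [_ xU _] := xP => S0 ST.
by have := xU S S0; have := polytope_induced_ge S0 ST; lra.
Qed.

Lemma polytope_tight_degrees A B :
  A != set0 -> B != setT -> A \proper B ->
  weight x (cut A) = mu -> weight x (cut B) = mu ->
  weight x (edges_between ends A (~: B)) = 0 ->
  \sum_(v in B :\: A) weight x (cut [set v]) = 2 * mu * #|B :\: A|%:R.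
Proof.
move=> A0 BT AB cutA cutB AB0; rewrite sum_degrees.
have AsB := proper_sub AB; have [_ xU _] := xP.
have AT : A != setT.
  by apply: contraTneq AB => ->; rewrite properE subsetT andbF.
have B0 : B != set0.
  by apply: contraTneq AB => ->; rewrite properE sub0set andbF.
have := polytope_induced_ge A0 AT; have := polytope_induced_ge B0 BT.
have := xU _ A0; have := xU _ B0.
have := weight_cut_setD ends x AsB; have := weight_induced_setD ends x AsB.
have -> : #|B|%:R = #|A|%:R + #|B :\: A|%:R :> R.
  by rewrite -natrD -(cardsID A B) (setIidPr AsB).
rewrite cutA cutB AB0; lra.
Qed.

End Point.

Section TreePoint.
Variable T : {set E}.
Hypothesis TP : tree_point T.

Let card_induced_lt U : U != set0 -> (#|T :&: induced U| < #|U|)%N.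
Proof.
have [_ TU _] := TP => /TU; rewrite weight_indicator mul1r lerBrDr natr1.
by rewrite ler_nat.
Qed.

Lemma tree_point_connected : spans_connected ends T.
Proof.
pose adj a b := [exists e in T, joins ends e a b].
move=> u v; rewrite -/(connect adj u v); apply: contraT => uv.
pose U := [set w | connect adj u w].
have U0 : U != set0 by apply/set0Pn; exists u; rewrite inE connect0.
have UT : U != setT.
  by apply: contraNneq uv => /setP/(_ v); rewrite !inE.
have := polytope_cut_ge TP U0 UT; rewrite weight_indicator (_ : _ :&: _ = set0).
  by rewrite cards0 ler10.
have U_closed a b e : e \in T -> joins ends e a b -> a \in U -> b \in U.
  rewrite !inE => eT eab ua; apply: connect_trans ua (connect1 _).
  by apply/existsP; exists e; rewrite eT.
have joins_ends e : joins ends e (ends e).1 (ends e).2.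
  by rewrite /joins -surjective_pairing eqxx.
have joinsC e a b : joins ends e a b = joins ends e b a by rewrite /joins orbC.
apply/setP => e; rewrite in_set0; apply/setIP => -[eT].
rewrite in_set !in_setC => /orP[/andP[e1 /negP]|/andP[/negP + e2]]; apply.
  exact: U_closed eT (joins_ends e) e1.
by apply: U_closed eT _ e2; rewrite joinsC.
Qed.

Lemma tree_point_acyclic : ~ has_cycle ends T.
Proof.
case=> n [v [e [v_inj e_inj eT ev]]].
have U0 : v @: setT != set0 by apply/set0Pn; exists (v ord0); rewrite imset_f.
have := card_induced_lt U0; rewrite (card_imset _ v_inj) ltnNge => /negP[].
rewrite -(card_imset _ e_inj); apply: subset_leq_card; apply/subsetP => f.
move=> /imsetP[i _ ->]; rewrite inE eT mem_induced.
by case/orP: (ev i) => /eqP -> /=; rewrite !imset_f.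
Qed.

Lemma tree_point_spanning_tree : spanning_tree ends T.
Proof. by split; [exact: tree_point_connected|exact: tree_point_acyclic]. Qed.

End TreePoint.

Lemma matroid_base_tree_point (r : {set E} -> nat) T : matroid_rank r ->
  (forall U, U != set0 -> (r (induced U) < #|U|)%N) -> (r setT).+1 = #|V| ->
  matroid_base r T -> tree_point T.
Proof.
move=> rM rU rT bT; split=> [e|U U0|]; first exact: ler0n.
  rewrite weight_indicator mul1r lerBrDr natr1 ler_nat.
  exact: leq_ltn_trans (matroid_base_cardI rM _ bT) (rU _ U0).
case/andP: bT => _ /eqP TE.
by rewrite weight_indicator setIT TE -rT mul1r -natr1 addrK.
Qed.

End ScaledPolytope.

Section ConvexHull.
Variables (R : realType) (E : finType).
Implicit Types (B : {set E} -> Prop) (y : E -> R) (F : {set E}) (t : R).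

Lemma in_convex_hullS B B' y :
  (forall T, B T -> B' T) -> in_convex_hull B y -> in_convex_hull B' y.
Proof.
move=> BB' [n [c [T [c0 c1 BT yE]]]]; exists n, c, T; split=> // i.
exact: BB'.
Qed.

Lemma in_convex_hull_weight_le B y F t : in_convex_hull B y ->
  (forall T, B T -> #|T :&: F|%:R <= t) -> weight y F <= t.
Proof.
move=> [n [c [T [c0 c1 BT yE]]]] B_le.
rewrite (eq_weight _ (yE : y =1 indicator_sum c T)) weight_indicator_sum.
have -> : t = \sum_(i < n) c i * t by rewrite -mulr_suml c1 mul1r.
by apply: ler_sum => i _; rewrite ler_wpM2l // B_le.
Qed.

Lemma in_convex_hull_weight B y F t : in_convex_hull B y ->
  (forall T, B T -> #|T :&: F|%:R = t) -> weight y F = t.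
Proof.
move=> [n [c [T [c0 c1 BT yE]]]] B_eq.
rewrite (eq_weight _ (yE : y =1 indicator_sum c T)) weight_indicator_sum.
have -> : t = \sum_(i < n) c i * t by rewrite -mulr_suml c1 mul1r.
by apply: eq_bigr => i _; rewrite B_eq.
Qed.

Lemma in_convex_hull_polytope (V : finType) (ends : E -> V * V) (mu : R) B y :
  in_convex_hull B y ->
  (forall T, B T -> in_scaled_polytope ends mu (indicator R T)) ->
  in_scaled_polytope ends mu y.
Proof.
move=> yB BP; split=> [e|U U0|].
- have [n [c [T [c0 _ _ ->]]]] := yB.
  by apply: sumr_ge0 => i _; rewrite mulr_ge0.
- apply: in_convex_hull_weight_le yB _ => T /BP[_ TU _].
  by rewrite -(weight_indicator R); exact: TU.
- apply: in_convex_hull_weight yB _ => T /BP[_ _ <-].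
  by rewrite weight_indicator.
Qed.

End ConvexHull.

(** * Peeling off one layer *)

Section ChainLevels.
Variables (V E : finType) (ends : E -> V * V) (W : {set {set V}}).
Implicit Types (v : V) (A B S : {set V}) (t : nat).
Local Open Scope nat_scope.

Definition totally_nested :=
  {in W &, forall A B, (A \subset B) || (B \subset A)}.

Hypothesis W_nested : totally_nested.

Lemma chain_level_subproof v : #|[set S in W | v \notin S]| < #|W|.+1.
Proof. by rewrite ltnS subset_leq_card // setIdE subsetIl. Qed.

Definition chain_level v : 'I_#|W|.+1 := Ordinal (chain_level_subproof v).
Definition chain_index S := #|[set A in W | A \proper S]|.

Lemma chain_index_lt S : S \in W -> chain_index S < #|W|.
Proof.
move=> SW; apply: proper_card; apply/properP; split.
  by rewrite setIdE subsetIl.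
by exists S; rewrite // !inE properxx andbF.
Qed.

Lemma mem_chain v S : S \in W -> (v \in S) = (chain_level v <= chain_index S).
Proof.
move=> SW; rewrite /chain_index /=; apply/idP/idP => [vS|].
  apply: subset_leq_card; apply/subsetP => A; rewrite !inE => /andP[AW vA].
  have AS : ~~ (S \subset A) by apply: contra vA => /subsetP; apply.
  rewrite AW properE AS andbT.
  by have := W_nested AW SW; rewrite (negPf AS) orbF.
apply: contraTT => vS; rewrite -ltnNge; apply: proper_card; apply/properP.
split.
  apply/subsetP => A; rewrite !inE => /andP[-> /proper_sub/subsetP AS].
  by apply: contra vS => /AS.
by exists S; rewrite !inE ?SW // properxx andbF.
Qed.

Lemma chain_index_proper A B : A \in W -> B \in W ->
  (A \proper B) = (chain_index A < chain_index B).
Proof.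
move=> AW BW; apply/idP/idP => [AB|].
  apply: proper_card; apply/properP; split.
    by apply/subsetP => S; rewrite !inE => /andP[-> /proper_trans]; apply.
  by exists A; rewrite !inE AW ?AB // properxx.
apply: contraTT; rewrite -leqNgt properE negb_and negbK => nAB.
have BA : B \subset A by have := W_nested AW BW; case/orP: nAB => [/negPf->|].
apply: subset_leq_card; apply/subsetP => S; rewrite !inE => /andP[-> SB].
exact: proper_sub_trans SB BA.
Qed.

Lemma chain_index_inj : {in W &, injective chain_index}.
Proof.
move=> A B AW BW AB; apply/eqP; apply: contraT => A_neq_B.
have [AsB|BsA] := orP (W_nested AW BW).
  have : A \proper B by rewrite properEneq A_neq_B.
  by rewrite chain_index_proper // AB ltnn.
have : B \proper A by rewrite properEneq eq_sym A_neq_B.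
by rewrite chain_index_proper // AB ltnn.
Qed.

Lemma chain_index_onto t : t < #|W| -> exists2 S, S \in W & chain_index S = t.
Proof.
pose index_of i : 'I_#|W| := Ordinal (chain_index_lt (enum_valP i)).
have index_inj : injective index_of.
  move=> i j /(congr1 val) /= ij; apply: enum_val_inj.
  by apply: chain_index_inj ij; exact: enum_valP.
move=> tW; have [at_index _ indexK] := injF_bij index_inj.
exists (enum_val (at_index (Ordinal tW))); first exact: enum_valP.
by have /(congr1 val) := indexK (Ordinal tW).
Qed.

Lemma cut_chainE S : S \in W ->
  cut ends S = [set e | crosses ends chain_level e (chain_index S)].
Proof.
move=> SW; apply/setP => e; rewrite !inE !mem_chain // /crosses /low /high.
by clear; lia.
Qed.

Lemma between_chainE A B : A \in W -> B \in W -> A \proper B ->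
  edges_between ends A (~: B) =
  [set e | low ends chain_level e <= chain_index A &
           chain_index B < high ends chain_level e].
Proof.
move=> AW BW; rewrite chain_index_proper // => AB; apply/setP => e.
by rewrite !inE !mem_chain // /low /high; move: AB; clear; lia.
Qed.

Lemma chain_lower_set b : b <= #|W| -> exists2 A, A \in set0 |: W &
  forall v, (v \in A) = (chain_level v < b).
Proof.
case: b => [_|b bW]; first by exists set0 => [|v]; rewrite ?setU11 // inE.
have [S SW Sb] := chain_index_onto bW.
by exists S => [|v]; rewrite ?setU1r // mem_chain // Sb.
Qed.

Lemma chain_upper_set b : 0 < b <= #|W|.+1 -> exists2 B, B \in setT |: W &
  forall v, (v \in B) = (chain_level v < b).
Proof.
case: b => // b bW; move: (bW : b <= #|W|).
rewrite leq_eqVlt => /predU1P[->|{}bW].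
  by exists setT => [|v]; rewrite ?setU11 // in_setT ltn_ord.
have [S SW Sb] := chain_index_onto bW.
by exists S => [|v]; rewrite ?setU1r // mem_chain // Sb.
Qed.

End ChainLevels.

Section PeelLayer.
Variables (R : realType) (V E : finType) (ends : E -> V * V).
Implicit Types (x y z : E -> R) (mu lam : R) (A B S : {set V}) (T : {set E}).

Local Notation cut := (cut ends).
Local Notation induced := (induced_edges ends).
Local Notation between := (edges_between ends).

Definition proper_chain (W : {set {set V}}) :=
  [/\ totally_nested W, set0 \notin W & setT \notin W].

Definition scaled_chain_point mu (W : {set {set V}}) x :=
  in_scaled_polytope ends mu x /\
  {in W &, forall A B, A \proper B ->
    \sum_(v in B :\: A) weight x (cut [set v]) = 2 * mu * #|B :\: A|%:R}.

Variables (W : {set {set V}}) (x : E -> R) (mu lam : R).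
Hypothesis W_proper : proper_chain W.
Hypothesis xW : scaled_chain_point mu W x.
Hypotheses (lam_gt0 : 0 < lam) (lam_le : lam <= mu).
Hypothesis x_cut : {in W, forall S, weight x (cut S) <= 2 * mu - lam}.

Local Notation lev := (chain_level W).
Local Notation layered_rank := (layered_rank ends lev).
Local Notation graphic_rank := (graphic_rank ends).

Let W_nested : totally_nested W. Proof. by case: W_proper. Qed.
Let xP : in_scaled_polytope ends mu x. Proof. by case: xW. Qed.
Let x_ge0 e : 0 <= x e. Proof. by case: xP. Qed.
Let mu_gt0 : 0 < mu. Proof. exact: lt_le_trans lam_le. Qed.
Let mu_lam_ge0 : 0 <= mu - lam. Proof. by rewrite subr_ge0. Qed.

Let W_neq0 S : S \in W -> S != set0.
Proof. by have [_ W0 _] := W_proper; apply: contraTneq => ->. Qed.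

Let W_neqT S : S \in W -> S != setT.
Proof. by have [_ _ WT] := W_proper; apply: contraTneq => ->. Qed.

Let setT_neq0 : [set: V] != set0.
Proof.
rewrite -card_gt0 cardsT lt0n; apply/eqP => V0; have [_ _ xT] := xP.
by have := weight_ge0 setT x_ge0; rewrite xT V0; move: mu_gt0; lra.
Qed.

Lemma chain_cuts_sum A B : A \in W -> B \in W -> A \proper B ->
  weight x (cut A) + weight x (cut B) = 2 * mu * #|B :\: A|%:R
    - 2 * weight x (induced (B :\: A)) + 2 * weight x (between A (~: B)).
Proof.
move=> AW BW AB; have [_ /(_ A B AW BW AB)] := xW.
by rewrite (sum_degrees xP) (weight_cut_setD _ _ (proper_sub AB)); lra.
Qed.

Lemma chain_skip_le A B : A \in W -> B \in W -> A \proper B ->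
  weight x (between A (~: B)) <= mu - lam.
Proof.
move=> AW BW AB; have [_ xU _] := xP.
have /xU : B :\: A != set0.
  by have /properP[_ [v vB vA]] := AB; apply/set0Pn; exists v; rewrite inE vA.
have := chain_cuts_sum AW BW AB; have := x_cut AW; have := x_cut BW.
by lra.
Qed.

Lemma chain_interval_ge A B :
  A \in set0 |: W -> B \in setT |: W -> A \subset B ->
  mu * #|B :\: A|%:R - 2 * mu + lam <= weight x (induced (B :\: A)).
Proof.
move=> /setU1P[->|AW] /setU1P[->|BW] AB.
- have [_ _ xT] := xP; rewrite setD0 induced_setT xT cardsT.
  by move: lam_le; lra.
- rewrite setD0; have := polytope_induced_ge xP (W_neq0 BW) (W_neqT BW).
  by have := x_cut BW; lra.
- rewrite setTD; have := x_cut AW; rewrite -cut_setC.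
  have CA0 : ~: A != set0 by rewrite setC_neq0 W_neqT.
  have CAT : ~: A != setT by rewrite setC_neqT W_neq0.
  by have := polytope_induced_ge xP CA0 CAT; lra.
- have [->|A_neq_B] := eqVneq A B.
    rewrite setDv cards0 mulr0; have := weight_ge0 (induced set0) x_ge0.
    by move: lam_le mu_gt0; lra.
  have {}AB : A \proper B by rewrite properEneq A_neq_B.
  have := chain_cuts_sum AW BW AB; have := x_cut AW; have := x_cut BW.
  by have := weight_ge0 (between A (~: B)) x_ge0; lra.
Qed.

Lemma chain_rank_inequality F :
  weight x F <= lam * (layered_rank F)%:R + (mu - lam) * (graphic_rank F)%:R.
Proof.
have [_ x_induced _] := xP.
apply: (rank_inequality (lev := lev)) => // [t|t t_gt0|a b /andP[ab bW]].
- have [S SW St] := chain_index_onto W_nested (ltn_ord t).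
  by rewrite -St -(cut_chainE _ W_nested) // x_cut.
- have [B BW Bt] := chain_index_onto W_nested (ltn_ord t).
  have tW : (t.-1 < #|W|)%N by exact: leq_ltn_trans (leq_pred t) (ltn_ord t).
  have [A AW At] := chain_index_onto W_nested tW.
  have AB : A \proper B.
    by rewrite (chain_index_proper W_nested) // At Bt prednK.
  apply: le_trans (chain_skip_le AW BW AB); apply: le_weight => //.
  apply/subsetP => e; rewrite (between_chainE _ W_nested) // At Bt !inE.
  by move: t_gt0; clear; lia.
- have [A AW Aa] := chain_lower_set W_nested (leq_trans ab bW : (a <= #|W|)%N).
  have b_gt0 : (0 < b <= #|W|.+1)%N by rewrite bW andbT (leq_ltn_trans _ ab).
  have [B BW Bb] := chain_upper_set W_nested b_gt0.
  have -> : level_interval lev a b = B :\: A.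
    by apply/setP => v; rewrite !inE Aa Bb -leqNgt.
  apply: chain_interval_ge => //; apply/subsetP => v; rewrite Aa Bb => va.
  exact: ltn_trans va ab.
Qed.

Lemma graphic_rank_setT : (graphic_rank setT).+1 = #|V|.
Proof.
have [_ xU xT] := xP; apply/eqP; rewrite eqn_leq; apply/andP; split.
  have := graphic_rank_induced_lt ends setT_neq0.
  by rewrite induced_setT cardsT.
have := weight_le_graphic_rank setT x_ge0 xU.
by rewrite xT ler_pM2l // lerBlDr natr1 ler_nat.
Qed.

Lemma layered_rank_setT : (layered_rank setT).+1 = #|V|.
Proof.
have [_ _ xT] := xP; apply/eqP; rewrite eqn_leq; apply/andP; split.
  have := layered_rank_induced_lt ends lev setT_neq0.
  by rewrite induced_setT cardsT.
rewrite -(ler_nat R) -(ler_pM2l lam_gt0) -natr1.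
have := chain_rank_inequality setT.
by rewrite xT -graphic_rank_setT -!natr1; lra.
Qed.

Lemma graphic_base_tree_point T : matroid_base graphic_rank T ->
  tree_point R ends T.
Proof.
apply: matroid_base_tree_point graphic_rank_setT.
  exact: graphic_rank_matroid.
exact: graphic_rank_induced_lt.
Qed.

Lemma layered_base_tree_point T : matroid_base layered_rank T ->
  tree_point R ends T.
Proof.
apply: matroid_base_tree_point layered_rank_setT.
  exact: layered_rank_matroid.
exact: layered_rank_induced_lt.
Qed.

Lemma layered_base_cut T S : matroid_base layered_rank T -> S \in W ->
  #|T :&: cut S| = 1%N.
Proof.
move=> bT SW; apply/eqP; rewrite eqn_leq; apply/andP; split.
  apply: leq_trans (matroid_base_cardI (layered_rank_matroid ends lev) _ bT) _.
  rewrite (cut_chainE _ W_nested) //.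
  by apply: (layered_rank_crossing (t := chain_index W S)) => e; rewrite inE.
have := polytope_cut_ge (layered_base_tree_point bT) (W_neq0 SW) (W_neqT SW).
by rewrite weight_indicator ler1n.
Qed.

Lemma layered_base_skip T A B : matroid_base layered_rank T ->
  A \in W -> B \in W -> A \proper B ->
  #|T :&: between A (~: B)| = 0%N.
Proof.
move=> bT AW BW AB; apply/eqP; rewrite -leqn0.
apply: leq_trans (matroid_base_cardI (layered_rank_matroid ends lev) _ bT) _.
rewrite leqn0; apply/eqP/layered_rank_skip => e.
rewrite (between_chainE _ W_nested) // inE.
by move: AB; rewrite (chain_index_proper W_nested) //; clear; lia.
Qed.

Lemma layered_base_Gao T : matroid_base layered_rank T -> Gao_tree ends W T.
Proof.
move=> bT; split=> [|S]; last exact: layered_base_cut.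
exact: tree_point_spanning_tree (layered_base_tree_point bT).
Qed.

Lemma peel_layer : exists y z : E -> R,
  [/\ in_convex_hull (Gao_tree ends W) y, scaled_chain_point (mu - lam) W z,
      {in W, forall S, weight z (cut S) = weight x (cut S) - lam}
    & forall e, x e = lam * y e + z e].
Proof.
pose r (b : bool) := if b then layered_rank else graphic_rank.
pose a (b : bool) := if b then lam else mu - lam.
have [|F||y yB xE] := @sum_base_polytopes R E bool r a x _ _ _.
- by case; [exact: layered_rank_matroid|exact: graphic_rank_matroid].
- by rewrite big_bool /=; exact: chain_rank_inequality.
- have [_ _ ->] := xP; rewrite big_bool /=.
  rewrite -{1}layered_rank_setT -natr1 addrK.
  by move: layered_rank_setT graphic_rank_setT => <- [->]; lra.
have xyz e : x e = lam * y true e + (mu - lam) * y false e.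
  by rewrite xE big_bool.
pose z e := (mu - lam) * y false e.
have zE F : weight z F = weight x F - lam * weight (y true) F.
  rewrite -weight_scale /weight -sumrB; apply: eq_bigr => e _.
  by rewrite xyz addrC addKr.
have yP := in_convex_hull_polytope (yB true) layered_base_tree_point.
have y_cut S : S \in W -> weight (y true) (cut S) = 1.
  move=> SW; apply: in_convex_hull_weight (yB true) _ => T bT.
  by rewrite layered_base_cut.
exists (y true), z; split=> [|||e]; last exact: xyz.
- exact: in_convex_hullS layered_base_Gao (yB true).
- split=> [|A B AW BW AB].
    rewrite -[mu - lam]mulr1; apply: in_scaled_polytopeZ => //.
    exact: in_convex_hull_polytope (yB false) graphic_base_tree_point.
  under eq_bigr => v _ do rewrite zE.
  have [_ xdeg] := xW; rewrite sumrB -mulr_sumr xdeg //.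
  rewrite (polytope_tight_degrees yP) ?W_neq0 ?W_neqT ?y_cut //; first by ring.
  apply: in_convex_hull_weight (yB true) _ => T bT.
  by rewrite layered_base_skip.
- by move=> S SW; rewrite zE y_cut // mulr1.
Qed.

End PeelLayer.

(** * Layered convex combinations *)

Section LayeredDecomposition.
Variables (R : realType) (V E : finType) (ends : E -> V * V).
Implicit Types (x : E -> R) (W : {set {set V}}).

Local Notation cut := (cut ends).

(* layer_value for a point whose total mass, the sum of lam, need not be 1. *)
Definition scaled_layer_value l (lam : 'I_l -> R) (j : 'I_l) : R :=
  2 * (\sum_t lam t) - \sum_(t < l | (t <= j)%N) lam t.

Lemma scaled_layer_value0 l (lam : 'I_l.+1 -> R) :
  scaled_layer_value lam ord0 = 2 * (\sum_t lam t) - lam ord0.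
Proof.
rewrite /scaled_layer_value [X in _ - X](big_pred1 ord0) // => t.
by rewrite /= leqn0.
Qed.

Lemma scaled_layer_value_lift l (lam : 'I_l.+1 -> R) j :
  scaled_layer_value lam (lift ord0 j) =
  scaled_layer_value (lam \o lift ord0) j + lam ord0.
Proof.
rewrite /scaled_layer_value big_ord_recl [X in _ - X]big_mkcond big_ord_recl /=.
by rewrite -big_mkcond /=; ring.
Qed.

Lemma scaled_layer_value_lift_lt l (lam : 'I_l.+1 -> R) j :
  (forall t, 0 < lam t) ->
  scaled_layer_value lam (lift ord0 j) < scaled_layer_value lam ord0.
Proof.
move=> lam_gt0; rewrite ltrD2l ltrN2.
rewrite [ltLHS](big_pred1 ord0) => [|t]; last first.
  by rewrite /= leqn0.
rewrite (bigD1 ord0) //= ltrDl (bigD1 (lift ord0 j)) /= ?leqnn // ltr_pwDl //.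
by apply: sumr_ge0 => t _; exact: ltW.
Qed.

Lemma scaled_layer_value_le l (lam : 'I_l.+1 -> R) j : (forall t, 0 < lam t) ->
  scaled_layer_value lam j <= 2 * (\sum_t lam t) - lam ord0.
Proof.
move=> lam_gt0; rewrite -scaled_layer_value0.
by case: (unliftP ord0 j) => [i ->|->//]; exact/ltW/scaled_layer_value_lift_lt.
Qed.

Lemma Gao_treeS W W' T :
  W' \subset W -> Gao_tree ends W T -> Gao_tree ends W' T.
Proof. by move=> /subsetP W'W [treeT cutT]; split=> // S /W'W/cutT. Qed.

Lemma proper_chainS W W' : W' \subset W -> proper_chain W -> proper_chain W'.
Proof.
move=> /subsetP WW' [nested W0 WT]; split=> [A B /WW' AW /WW' BW||].
- exact: nested.
- by apply: contra W0 => /WW'.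
- by apply: contra WT => /WW'.
Qed.

Lemma scaled_chain_pointS mu W W' x : W' \subset W ->
  scaled_chain_point ends mu W x -> scaled_chain_point ends mu W' x.
Proof.
by move=> /subsetP WW' [xP xdeg]; split=> // A B /WW' + /WW'; exact: xdeg.
Qed.

Lemma scaled_polytope0 x : in_scaled_polytope ends 0 x -> forall e, x e = 0.
Proof.
move=> [x0 _ xT] e; move/eqP: xT; rewrite mul0r psumr_eq0 // => /allP/(_ e).
by rewrite mem_index_enum inE => /(_ isT)/eqP.
Qed.

Lemma layered_decomposition l (lam : 'I_l -> R) W x :
  (forall j, 0 < lam j) -> proper_chain W ->
  scaled_chain_point ends (\sum_j lam j) W x ->
  {in W, forall S, exists j, weight x (cut S) = scaled_layer_value lam j} ->
  exists2 y : 'I_l -> E -> R,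
    forall j, in_convex_hull (Gao_tree ends
      [set S in W | weight x (cut S) <= scaled_layer_value lam j]) (y j)
    & forall e, x e = \sum_j lam j * y j e.
Proof.
elim: l lam W x => [|l IHl] lam W x lam_gt0 W_proper xW x_cut.
  have [xP _] := xW; exists (fun=> x) => [[]//|e]; rewrite big_ord0.
  by apply: scaled_polytope0; rewrite big_ord0 in xP.
pose lam' := lam \o lift ord0; set mu := \sum_j lam j in xW *.
have muE : mu = lam ord0 + \sum_j lam' j by rewrite /mu big_ord_recl.
have lam_le : lam ord0 <= mu.
  by rewrite muE lerDl sumr_ge0 // => j _; exact/ltW/lam_gt0.
have cut_le : {in W, forall S, weight x (cut S) <= 2 * mu - lam ord0}.
  by move=> S /x_cut[j ->]; exact: scaled_layer_value_le.
have [y0 [z [y0W zW z_cut xE]]] :=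
  peel_layer W_proper xW (lam_gt0 _) lam_le cut_le.
pose W' := [set S in W | weight x (cut S) < scaled_layer_value lam ord0].
have W'W : W' \subset W by rewrite /W' setIdE subsetIl.
have [|||S|y yW' zE] := IHl lam' W' z.
- by move=> j; exact: lam_gt0.
- exact: proper_chainS W_proper.
- by apply: scaled_chain_pointS W'W _; rewrite muE addrC addKr in zW.
- rewrite inE => /andP[SW]; have [j jE] := x_cut S SW; rewrite jE.
  case: (unliftP ord0 j) jE => [j' ->|->]; last by rewrite ltxx.
  by move=> jE _; exists j'; rewrite z_cut // jE scaled_layer_value_lift addrK.
exists (fun j => if unlift ord0 j is Some j' then y j' else y0) => [j|e].
  case: unliftP => [j' ->|->].
    apply: in_convex_hullS (yW' j') => T; apply/Gao_treeS/subsetP => S.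
    rewrite inE => /andP[SW S_le]; rewrite !inE SW z_cut //=.
    rewrite lerBlDr -scaled_layer_value_lift S_le andbT.
    exact: le_lt_trans S_le (scaled_layer_value_lift_lt _ _).
  apply: in_convex_hullS y0W => T; apply: Gao_treeS.
  by rewrite setIdE subsetIl.
rewrite xE zE big_ord_recl unlift_none; congr (_ + _).
by apply: eq_bigr => j _; rewrite liftK.
Qed.

End LayeredDecomposition.

Section ChainPoints.
Variables (V : finType) (k : nat) (C : 'I_k.+1 -> {set V}).
Hypothesis C_chain : is_chain C.

Lemma is_chain_subset (i j : 'I_k.+1) : (i <= j)%N -> C i \subset C j.
Proof.
have [_ C_lt _] := C_chain; rewrite leq_eqVlt => /predU1P[/ord_inj->//|/C_lt].
exact: proper_sub.
Qed.

Lemma is_chain_proper_chain : proper_chain (C @: setT).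
Proof.
have [C0 C_lt CT] := C_chain; split=> [_ _ /imsetP[i _ ->] /imsetP[j _ ->]||].
- by case/orP: (leq_total i j) => /is_chain_subset ->; rewrite ?orbT.
- apply: contra C0 => /imsetP[i _ Ci]; rewrite -subset0 Ci.
  exact: is_chain_subset.
- apply: contraL CT => /imsetP[i _ Ci]; rewrite properE Ci.
  by rewrite (@is_chain_subset i ord_max) ?andbF // -ltnS.
Qed.

Lemma chain_at_ord (i : 'I_k.+1) : chain_at C i = C i.
Proof. by rewrite /chain_at valK. Qed.

Lemma chain_at_subset t : (t < k)%N -> chain_at C t \subset chain_at C t.+1.
Proof.
move=> tk; have tk1 : (t.+1 < k.+1)%N by [].
have /= -> := chain_at_ord (Ordinal tk1).
have /= -> := chain_at_ord (Ordinal (ltnW tk1)).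
exact: is_chain_subset.
Qed.

Lemma sum_chain_const (M : nmodType) (h : V -> M) :
  (forall t, (1 <= t <= k)%N -> \sum_(v in level C t) h v = 0) ->
  forall i, \sum_(v in C i) h v = \sum_(v in C ord0) h v.
Proof.
move=> h0 i; rewrite -!chain_at_ord.
have : (i <= k)%N by rewrite -ltnS.
elim: (i : nat) => // t IHt tk; rewrite -IHt ?(ltnW tk) //.
rewrite (big_setID (chain_at C t)) /= -/(level C t.+1) h0 // addr0.
by rewrite (setIidPr (chain_at_subset tk)).
Qed.

Lemma chain_point_scaled (R : realType) (E : finType) (ends : E -> V * V)
    (x : E -> R) :
  chain_point ends C x -> scaled_chain_point ends 1 (C @: setT) x.
Proof.
move=> [[x0 xU xT] _ xdeg]; split.
  by split=> // [U U0|]; rewrite mul1r ?xU.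
pose h v := weight x (cut ends [set v]) - 2.
have h_level t : (1 <= t <= k)%N -> \sum_(v in level C t) h v = 0.
  by move=> tk; rewrite sumrB xdeg // sumr_const mulr_natr subrr.
move=> _ _ /imsetP[i _ ->] /imsetP[j _ ->] /proper_sub Cij; apply/eqP.
rewrite mulr1 -subr_eq0 mulr_natr -sumr_const -sumrB; apply/eqP.
have := sum_chain_const h_level j; rewrite (big_setID (C i)) /= (setIidPr Cij).
by rewrite sum_chain_const // -[RHS]addr0 => /addrI.
Qed.

Lemma narrow_setsE (R : realType) (E : finType) (ends : E -> V * V)
    (x : E -> R) (b : R) :
  narrow_sets ends C x b = [set S in C @: setT | weight x (cut ends S) <= b].
Proof.
apply/setP => S; rewrite [RHS]inE.
apply/imsetP/andP => [[i + ->]|[/imsetP[i _ ->] Ci]].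
  by rewrite inE => Ci; rewrite imset_f.
by exists i; rewrite ?inE.
Qed.

End ChainPoints.

Theorem theorem1 (R : realType) (V E : finType) (ends : E -> V * V)
    (k : nat) (C : 'I_k.+1 -> {set V}) (x : E -> R)
    (l : nat) (lam : 'I_l -> R) :
  is_chain C ->
  chain_point ends C x ->
  narrow_cut_layers ends C x lam ->
  exists y : 'I_l -> E -> R, layered_convex_combination ends C x lam y.
Proof.
move=> C_chain x_point [lam_gt0 layers lam_total].
have lam1 : \sum_j lam j = 1 by lra.
have layerE j : scaled_layer_value lam j = layer_value lam j.
  by rewrite /scaled_layer_value lam1 mulr1.
have xW : scaled_chain_point ends (\sum_j lam j) (C @: setT) x.
  by rewrite lam1; exact: chain_point_scaled.
have W_proper := is_chain_proper_chain C_chain.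
have [_ /imsetP[i _ ->]|y yW xE] := layered_decomposition lam_gt0 W_proper xW.
  have [cut_layer _] := layers (weight x (cut ends (C i))).
  have [j jE] := cut_layer (ex_intro _ i erefl).
  by exists j; rewrite layerE.
by exists y; split=> // j; rewrite narrow_setsE -layerE.
Qed.
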